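(* Let $\mathbb{K}$ be a field and let $A=\mathbb{K}[X_1][X_2;\alpha_2,\delta_2]_P\cdots[X_n;\alpha_n,\delta_n]_P$ be an iterated Poisson-Ore extension such that, for each $2\le i\le n$, the derivation $\delta_i$ extends to an iterative, locally nilpotent higher $(\eta_i,\alpha_i)$-skew Poisson derivation $(D_{i,k})_{k\ge0}$ on $A_{i-1}=\mathbb{K}[X_1][X_2;\alpha_2,\delta_2]_P\cdots[X_{i-1};\alpha_{i-1},\delta_{i-1}]_P$, where each $\eta_i$ is a nonzero scalar of $\mathbb{K}$. Suppose furthermore that for all $1\le j<i\le n$ there exists $\lambda_{ij}\in\mathbb{K}$ such that $\alpha_i(X_j)=\lambda_{ij}X_j$, and that $\alpha_iD_{j,k}=D_{j,k}\alpha_i+k\lambda_{ij}D_{j,k}$ on $A_{j-1}$ for all $2\le j<i\le n$ and $k\ge0$. Let $\boldsymbol\lambda=(\lambda_{ij})\in M_n(\mathbb{K})$ be the skew-symmetric matrix whose coefficients below the diagonal are these scalars, and let $B=\mathbb{K}_{\boldsymbol\lambda}[Y_1,\dots,Y_n]$. Then: (1) There exists a Poisson algebra isomorphism between $\mathrm{Frac}\,A$ and $\mathbb{K}_{\boldsymbol\lambda}(Y_1,\dots,Y_n)$. (2) For any Poisson prime ideal $P$ of $A$, there exists a Poisson prime ideal $Q$ of $B$ such that the fields $\mathrm{Frac}(A/P)$ and $\mathrm{Frac}(B/Q)$ are isomorphic as Poisson algebras. (3) Assume that the torus $H=(\mathbb{K}^\times)^r$ acts rationally by Poisson automorphisms on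 $A$ such that each $X_i$ is an $H$-eigenvector, and endow $B$ with the induced $H$-action: if $h\in H$ and $h(X_i)=\mu_iX_i$ with $\mu_i\in\mathbb{K}^\times$, then $h(Y_i)=\mu_iY_i$ ($1\le i\le n$). Suppose moreover that, for every $h\in H$ (with $h(X_i)=\mu_iX_i$), $h(D_{i,k}(X_j))=\mu_i^kD_{i,k}(h(X_j))$ for all $1\le j<i\le n$ and $k\ge0$. Then for any $H$-invariant Poisson prime ideal $P$ of $A$ there exists an $H$-invariant Poisson prime ideal $Q$ of $B$ such that the fields $\mathrm{Frac}(A/P)$ and $\mathrm{Frac}(B/Q)$ are isomorphic as Poisson algebras.
   Context: A Poisson $\mathbb{K}$-algebra is a commutative $\mathbb{K}$-algebra with a skew-symmetric $\mathbb{K}$-bilinear bracket satisfying the Jacobi identity and the Leibniz rule; the bracket extends uniquely to localisations. A Poisson derivation is a $\mathbb{K}$-derivation $\alpha$ with $\alpha(\{a,b\})=\{\alpha(a),b\}+\{a,\alpha(b)\}$. A Poisson $\alpha$-derivation is a $\mathbb{K}$-derivation $\delta$ with $\delta(\{a,b\})=\{\delta(a),b\}+\{a,\delta(b)\}+\alpha(a)\delta(b)-\delta(a)\alpha(b)$. Given such $\alpha,\delta$ on $A$, the Poisson-Ore extension $A[X;\alpha,\delta]_P$ is $A[X]$ with the unique Poisson bracket extending that of $A$ with $\{X,a\}=\alpha(a)X+\delta(a)$. $\mathbb{K}[X_1]$ has zero bracket. A higher derivation on $A$ is a sequence $(D_i)_{i\ge0}$ of $\mathbb{K}$-linear maps $A\to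 A$ with $D_0=\mathrm{id}_A$ and $D_n(ab)=\sum_{i=0}^nD_i(a)D_{n-i}(b)$. It is iterative if $D_iD_j=\binom{i+j}{i}D_{i+j}$ for all $i,j$, and locally nilpotent if for each $a\in A$ there is $n\ge0$ with $D_i(a)=0$ for all $i\ge n$. It is a higher $(\eta,\alpha)$-skew Poisson derivation if moreover for all $a,b\in A$, $n\ge0$, $$D_n(\{a,b\})=\sum_{i=0}^n\Big(\{D_i(a),D_{n-i}(b)\}+i\big(\alpha D_{n-i}(a)D_i(b)-D_i(a)\,\alpha D_{n-i}(b)\big)\Big)$$ and $D_i\alpha=\alpha D_i+i\eta D_i$ for all $i\ge0$. ''$\delta$ extends to $(D_i)$'' means $D_1=\delta$. For skew-symmetric $\boldsymbol\lambda\in M_n(\mathbb{K})$, the Poisson affine space $\mathbb{K}_{\boldsymbol\lambda}[Y_1,\dots,Y_n]$ is the polynomial algebra with bracket determined by $\{Y_i,Y_j\}=\lambda_{ij}Y_iY_j$, and $\mathbb{K}_{\boldsymbol\lambda}(Y_1,\dots,Y_n)$ is its field of fractions with the extended bracket. A Poisson prime ideal is a prime ideal $P$ with $\{a,u\}\in P$ for all $a\in A$, $u\in P$. An ideal $I$ is $H$-invariant if $h(I)=I$ for all $h\in H$. The action of $H$ is rational if the algebra is the direct sum of its $H$-eigenspaces and the eigenvalues are rational characters of $H$. *)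

(* Defs.v *)
From HB Require Import structures.
From mathcomp Require Import all_boot all_algebra.
From mathcomp Require Import generic_quotient ring_quotient fraction.
From mathcomp Require Import mpoly.
From mathcomp Require Import ring.
From mathcomp Require Import boolp.

Set Implicit Arguments.
Unset Strict Implicit.
Unset Printing Implicit Defensive.

Import GRing.Theory.
Local Open Scope ring_scope.
Local Open Scope quotient_scope.

(* A commutative K-algebra is a commutative ring R together with its structure
   morphism iota : K -> R (in_alg R when R is canonically a comAlgType K); this
   also covers the quotients {ideal_quot P} and the fields {fraction R}, which
   carry no canonical K-module structure in the library. *)

Section PoissonAlgebra.

Variables (K : fieldType) (R : comNzRingType) (iota : {rmorphism K -> R}).
Variable br : R -> R -> R.

(* The alternating condition follows from skew-symmetry unless 2 = 0 in K, where
   it is what makes a bracket determined by its values on pairs of distinct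
   generators. *)
Record poisson_bracket : Prop := PoissonBracket {
  pbr_linear : forall c a b d,
    br (iota c * a + b) d = iota c * br a d + br b d;
  pbr_skew : forall a b, br a b = - br b a;
  pbr_alternating : forall a, br a a = 0;
  pbr_jacobi : forall a b c,
    br a (br b c) + br b (br c a) + br c (br a b) = 0;
  pbr_leibniz : forall a b c, br (a * b) c = a * br b c + br a c * b
}.

End PoissonAlgebra.

Record poisson_isomorphism (K : fieldType) (R S : comNzRingType)
    (iR : K -> R) (brR : R -> R -> R) (iS : K -> S) (brS : S -> S -> S)
    (f : R -> S) : Prop := PoissonIsomorphism {
  piso_zmod : zmod_morphism f;
  piso_monoid : monoid_morphism f;
  piso_scalar : forall c, f (iR c) = iS c;
  piso_bracket : {morph f : x y / brR x y >-> brS x y};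
  piso_bij : bijective f
}.

Definition poisson_isomorphic (K : fieldType) (R S : comNzRingType)
    (iR : K -> R) (brR : R -> R -> R) (iS : K -> S) (brS : S -> S -> S) : Prop :=
  exists f : R -> S, poisson_isomorphism iR brR iS brS f.

Definition poisson_ideal (R : comNzRingType) (br : R -> R -> R) (P : {pred R}) :=
  forall a u, u \in P -> br a u \in P.

(* The quotient by a prime ideal is a domain; its units are decided classically. *)
Section QuotientDomain.

Variables (R : comNzRingType) (P : prime_idealr R).
Local Notation Q := {ideal_quot P}.

Let qunit : pred Q := fun x => `[< exists y, y * x = 1 >].
Let qinv (x : Q) : Q :=
  if pselect (exists y, y * x = 1) is left h then projT1 (cid h) else x.

Fact quot_mulVx : {in qunit, left_inverse 1 qinv *%R}.
Proof.
move=> x /asboolP hx; rewrite /qinv; case: pselect => // h.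
exact: (projT2 (cid h)).
Qed.

Fact quot_unitPl : forall x y : Q, y * x = 1 -> qunit x.
Proof. by move=> x y h; apply/asboolP; exists y. Qed.

Fact quot_invr_out : {in [predC qunit], qinv =1 id}.
Proof.
move=> x /asboolPn hx; rewrite /qinv; case: pselect => // h.
Qed.

HB.instance Definition _ := GRing.ComNzRing_hasMulInverse.Build
  (Quotient.quot P) quot_mulVx quot_unitPl quot_invr_out.

HB.instance Definition _ := GRing.ComUnitRing_isIntegral.Build
  (Quotient.quot P) (@Quotient.rquot_IdomainAxiom R P).

End QuotientDomain.


Section BracketTheory.

Variables (R : comNzRingType) (br : R -> R -> R).
Hypothesis brD : forall a b d, br (a + b) d = br a d + br b d.
Hypothesis brC : forall a b, br a b = - br b a.
Hypothesis brM : forall a b c, br (a * b) c = a * br b c + br a c * b.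

Let brDr a b d : br d (a + b) = br d a + br d b.
Proof. by rewrite brC brD opprD -!brC. Qed.

Let brMr a b c : br c (a * b) = a * br c b + br c a * b.
Proof. by rewrite brC brM (brC b) (brC a); ring. Qed.

Definition jacobiator a b c := br a (br b c) + br b (br c a) + br c (br a b).

Lemma jacobiator_cycle a b c : jacobiator a b c = jacobiator b c a.
Proof. by rewrite /jacobiator; ring. Qed.

Lemma jacobiatorD a a' b c :
  jacobiator (a + a') b c = jacobiator a b c + jacobiator a' b c.
Proof. by rewrite /jacobiator !(brD, brDr); ring. Qed.

Lemma jacobiatorM a a' b c :
  jacobiator (a * a') b c = a * jacobiator a' b c + jacobiator a b c * a'.
Proof.
rewrite /jacobiator !(brM, brMr, brD, brDr) (brC b a) (brC b a'); ring.
Qed.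

End BracketTheory.

Section PoissonTheory.

Variables (K : fieldType) (R : comNzRingType) (iota : {rmorphism K -> R}).
Variable br : R -> R -> R.
Hypothesis brP : poisson_bracket iota br.

Lemma pbrD a b d : br (a + b) d = br a d + br b d.
Proof. by have := pbr_linear brP 1 a b d; rewrite rmorph1 !mul1r. Qed.

Lemma pbr0 d : br 0 d = 0.
Proof. by apply: (addrI (br 0 d)); rewrite -pbrD !addr0. Qed.

Lemma pbrZ c a d : br (iota c * a) d = iota c * br a d.
Proof. by have := pbr_linear brP c a 0 d; rewrite !addr0 pbr0 addr0. Qed.

Lemma pbr_scalar c d : br (iota c) d = 0.
Proof.
have br1 : br 1 d = 0.
  have := pbr_leibniz brP 1 1 d; rewrite !mul1r mulr1 => h.
  by apply: (addrI (br 1 d)); rewrite -h addr0.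
by rewrite -[iota c]mulr1 pbrZ br1 mulr0.
Qed.

Lemma pbrDr a b d : br d (a + b) = br d a + br d b.
Proof. by rewrite (pbr_skew brP) pbrD opprD -!(pbr_skew brP). Qed.

Lemma pbrN a d : br (- a) d = - br a d.
Proof. by apply: (addrI (br a d)); rewrite -pbrD !subrr pbr0. Qed.

Lemma pbrNr a d : br d (- a) = - br d a.
Proof. by rewrite (pbr_skew brP) pbrN -(pbr_skew brP). Qed.

Lemma pbrMr a b d : br d (a * b) = a * br d b + br d a * b.
Proof.
rewrite (pbr_skew brP) (pbr_leibniz brP) (pbr_skew brP d) (pbr_skew brP d).
ring.
Qed.

End PoissonTheory.

Section QuotientBracket.

Variables (R : comNzRingType) (br : R -> R -> R) (I : idealr R).

Definition quot_bracket (x y : {ideal_quot I}) : {ideal_quot I} :=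
  \pi_{ideal_quot I} (br (repr x) (repr y)).

Variables (K : fieldType) (iota : {rmorphism K -> R}).
Hypothesis brP : poisson_bracket iota br.
Hypothesis brI : poisson_ideal br I.

Lemma quot_bracketE a b :
  quot_bracket (\pi_{ideal_quot I} a) (\pi_{ideal_quot I} b)
    = \pi_{ideal_quot I} (br a b).
Proof.
have memI u : u - repr (\pi_{ideal_quot I} u) \in I.
  by rewrite Quotient.idealrBE reprK.
rewrite /quot_bracket; apply/esym/eqP; rewrite -Quotient.idealrBE.
set a' := repr _; set b' := repr _.
have -> : br a b - br a' b' = br a (b - b') - br b' (a - a').
  rewrite !(pbrDr brP) !(pbrNr brP) (pbr_skew brP b' a) (pbr_skew brP b' a').
  ring.
by rewrite rpredB ?brI ?memI.
Qed.

Lemma quot_bracket_poisson :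
  poisson_bracket (\pi_{ideal_quot I} \o iota) quot_bracket.
Proof.
split=> [c||||].
- elim/quotW=> x; elim/quotW=> y; elim/quotW=> z /=.
  rewrite -rmorphM -rmorphD !quot_bracketE -rmorphM -rmorphD.
  by rewrite (pbr_linear brP).
- elim/quotW=> x; elim/quotW=> y.
  by rewrite !quot_bracketE -rmorphN (pbr_skew brP).
- by elim/quotW=> x; rewrite quot_bracketE (pbr_alternating brP) rmorph0.
- elim/quotW=> x; elim/quotW=> y; elim/quotW=> z.
  rewrite (quot_bracketE y z) (quot_bracketE z x) (quot_bracketE x y).
  by rewrite !quot_bracketE -!rmorphD (pbr_jacobi brP) rmorph0.
- elim/quotW=> x; elim/quotW=> y; elim/quotW=> z.
  by rewrite -rmorphM !quot_bracketE -!rmorphM -rmorphD (pbr_leibniz brP).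
Qed.

End QuotientBracket.

Notation "x %:F" := (tofrac x) : ring_scope.

Lemma fraction_repr (R : idomainType) (x : {fraction R}) :
  x = (\n_(repr x))%:F / (\d_(repr x))%:F.
Proof.
have dn0 : (\d_(repr x))%:F != 0 :> {fraction R}.
  by rewrite tofrac_eq0 denom_ratioP.
apply: (mulIf dn0); rewrite divfK //.
rewrite -[X in X * _]reprK; unlock FracField.tofrac.
rewrite -[LHS](FracField.pi_mul _ _).
apply/eqP; rewrite piE /= FracField.equivfE /FracField.mulf.
by rewrite !numden_Ratio ?mulr1 ?oner_neq0 ?denom_ratioP // mulrC.
Qed.

Lemma fraction_ind (R : idomainType) (T : {fraction R} -> Prop) :
  (forall a b : R, b != 0 -> T (a%:F / b%:F)) -> forall x, T x.
Proof. by move=> h x; rewrite [x]fraction_repr; apply/h/denom_ratioP. Qed.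

Section QuotientRule.

Variable F : fieldType.

Let rule (a b c d ac bc ad bd : F) :=
  (b * d * ac - a * d * bc - b * c * ad + a * c * bd) / (b * d) ^+ 2.

Fact quotient_rule_leibniz (a b a' b' c d ac bc ad bd ac' bc' ad' bd' : F) :
  b != 0 -> b' != 0 -> d != 0 ->
  rule (a * a') (b * b') c d (a * ac' + ac * a') (b * bc' + bc * b')
      (a * ad' + ad * a') (b * bd' + bd * b')
    = a / b * rule a' b' c d ac' bc' ad' bd'
      + rule a b c d ac bc ad bd * (a' / b').
Proof.
by move=> b0 b'0 d0; rewrite /rule; field; rewrite b0 b'0 d0.
Qed.

Fact quotient_rule_additive (a b a' b' c d ac bc ad bd ac' bc' ad' bd' : F) :
  b != 0 -> b' != 0 -> d != 0 ->
  rule (a * b' + a' * b) (b * b') c d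
      (a * bc' + ac * b' + (a' * bc + ac' * b)) (b * bc' + bc * b')
      (a * bd' + ad * b' + (a' * bd + ad' * b)) (b * bd' + bd * b')
    = rule a b c d ac bc ad bd + rule a' b' c d ac' bc' ad' bd'.
Proof.
by move=> b0 b'0 d0; rewrite /rule; field; rewrite b0 b'0 d0.
Qed.

End QuotientRule.

Section FractionBracket.

Variables (R : idomainType) (br : R -> R -> R).

(* The quotient rule for {a / b, c / d}. *)
Definition ratio_bracket (a b c d : R) : {fraction R} :=
  (b * d * br a c - a * d * br b c - b * c * br a d + a * c * br b d)%:F
    / ((b * d) ^+ 2)%:F.

Definition frac_bracket (x y : {fraction R}) : {fraction R} :=
  ratio_bracket (\n_(repr x)) (\d_(repr x)) (\n_(repr y)) (\d_(repr y)).

Variables (K : fieldType) (iota : {rmorphism K -> R}).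
Hypothesis brP : poisson_bracket iota br.

Let ratio_bracketC a b c d : ratio_bracket a b c d = - ratio_bracket c d a b.
Proof.
rewrite /ratio_bracket -[RHS]mulNr -tofracN; congr (_%:F / _%:F); last ring.
rewrite (pbr_skew brP c) (pbr_skew brP c) (pbr_skew brP d) (pbr_skew brP d b).
ring.
Qed.

Let ratio_bracket_wdl (a b a' b' c d : R) : b != 0 -> b' != 0 -> d != 0 ->
  a * b' = a' * b -> ratio_bracket a b c d = ratio_bracket a' b' c d.
Proof.
move=> b0 b'0 d0 eq_ab; pose L z := d * br z c - c * br z d.
have LM u v : L (u * v) = u * L v + L u * v.
  by rewrite /L !(pbr_leibniz brP); ring.
have ratioE u v : ratio_bracket u v c d
    = (v * L u - u * L v)%:F / ((v * d) ^+ 2)%:F.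
  by rewrite /ratio_bracket /L; congr (_%:F / _); ring.
have vd0 v : v != 0 -> ((v * d) ^+ 2)%:F != 0 :> {fraction R}.
  by move=> v0; rewrite tofrac_eq0 sqrf_eq0 mulf_neq0.
rewrite !ratioE; apply/eqP; rewrite eqr_div ?vd0 // -!tofracM tofrac_eq.
apply/eqP.
have eL : b' * L a = a' * L b + L a' * b - a * L b'.
  by rewrite -LM -eq_ab LM; ring.
transitivity (d ^+ 2 * (b * b' * (b' * L a) - b' * (a * b') * L b)); first ring.
rewrite eL eq_ab.
transitivity (d ^+ 2 * (b * b * b' * L a' - b * (a * b') * L b')); first ring.
rewrite eq_ab; ring.
Qed.

Lemma frac_bracketE (a b c d : R) : b != 0 -> d != 0 ->
  frac_bracket (a%:F / b%:F) (c%:F / d%:F) = ratio_bracket a b c d.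
Proof.
move=> b0 d0; rewrite /frac_bracket.
have reprE u v : v != 0 ->
    \n_(repr (u%:F / v%:F : {fraction R})) * v
      = u * \d_(repr (u%:F / v%:F : {fraction R})).
  move=> v0; apply/eqP; rewrite -tofrac_eq !tofracM -eqr_div ?tofrac_eq0 //.
    by rewrite -fraction_repr.
  exact: denom_ratioP.
rewrite (@ratio_bracket_wdl _ _ a b) ?denom_ratioP ?reprE //.
by rewrite ratio_bracketC (@ratio_bracket_wdl _ _ c d) ?denom_ratioP ?reprE.
Qed.

Let brx1 a : br a 1 = 0.
Proof. by rewrite (pbr_skew brP) -(rmorph1 iota) (pbr_scalar brP) oppr0. Qed.

Let br1x a : br 1 a = 0.
Proof. by rewrite -(rmorph1 iota) (pbr_scalar brP). Qed.

Lemma frac_bracket_tofrac a b : frac_bracket a%:F b%:F = (br a b)%:F.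
Proof.
have -> : a%:F = a%:F / 1%:F by rewrite tofrac1 divr1.
have -> : b%:F = b%:F / 1%:F by rewrite tofrac1 divr1.
rewrite frac_bracketE ?oner_neq0 // /ratio_bracket !brx1 !br1x.
rewrite mulr1 expr1n tofrac1 divr1; congr _%:F; ring.
Qed.

Let skew x y : frac_bracket x y = - frac_bracket y x.
Proof. exact: ratio_bracketC. Qed.

Let fracE (a b c d : R) : b != 0 -> d != 0 ->
  frac_bracket (a%:F / b%:F) (c%:F / d%:F) =
    (b%:F * d%:F * (br a c)%:F - a%:F * d%:F * (br b c)%:F
       - b%:F * c%:F * (br a d)%:F + a%:F * c%:F * (br b d)%:F)
      / (b%:F * d%:F) ^+ 2.
Proof.
move=> b0 d0; rewrite frac_bracketE // /ratio_bracket.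
by rewrite !(tofracXn, tofracM, tofracD, tofracN).
Qed.

Let leibniz (x y z : {fraction R}) :
  frac_bracket (x * y) z = x * frac_bracket y z + frac_bracket x z * y.
Proof.
elim/fraction_ind: x => a b b0; elim/fraction_ind: y => a' b' b'0.
elim/fraction_ind: z => c d d0.
have bF0 v : v != 0 -> v%:F != 0 :> {fraction R} by rewrite tofrac_eq0.
rewrite mulf_div -!tofracM !fracE ?mulf_neq0 // !(pbr_leibniz brP).
rewrite !tofracD !tofracM.
by apply: quotient_rule_leibniz; rewrite bF0.
Qed.

Let additive (x y z : {fraction R}) :
  frac_bracket (x + y) z = frac_bracket x z + frac_bracket y z.
Proof.
elim/fraction_ind: x => a b b0; elim/fraction_ind: y => a' b' b'0.
elim/fraction_ind: z => c d d0.
have bF0 v : v != 0 -> v%:F != 0 :> {fraction R} by rewrite tofrac_eq0.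
rewrite addf_div ?bF0 // -!tofracM -tofracD !fracE ?mulf_neq0 //.
rewrite !(pbrD brP) !(pbr_leibniz brP) !tofracD !tofracM.
by apply: quotient_rule_additive; rewrite bF0.
Qed.

Let derivation0 (J : {fraction R} -> {fraction R}) :
  (forall x y : {fraction R}, J (x * y) = x * J y + J x * y) ->
  (forall a, J a%:F = 0) -> forall x, J x = 0.
Proof.
move=> JM J0; elim/fraction_ind=> a b b0.
have bF0 : b%:F != 0 :> {fraction R} by rewrite tofrac_eq0.
have := JM (a%:F / b%:F) b%:F; rewrite (divfK bF0) !J0 mulr0 add0r.
move=> /esym/eqP.
by rewrite mulf_eq0 (negPf bF0) orbF => /eqP.
Qed.

Lemma frac_bracket_poisson :
  poisson_bracket (@tofrac R \o iota) frac_bracket.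
Proof.
split=> [c x y z||x|x y z|].
- rewrite additive leibniz; congr (_ + _).
  suff -> : frac_bracket ((@tofrac R \o iota) c) z = 0.
    by rewrite mul0r addr0.
  rewrite skew; apply/eqP; rewrite oppr_eq0; apply/eqP.
  apply: (@derivation0 (frac_bracket^~ _)) => [x' y'|a]; first exact: leibniz.
  rewrite frac_bracket_tofrac (pbr_skew brP) (pbr_scalar brP) oppr0.
  exact: tofrac0.
- exact: skew.
- elim/fraction_ind: x => a b b0; rewrite fracE // !(pbr_alternating brP).
  rewrite (pbr_skew brP b a) tofracN tofrac0.
  by rewrite [X in X / _](_ : _ = 0) ?mul0r //; ring.
- pose J := jacobiator frac_bracket.
  have JM a a' b c : J (a * a') b c = a * J a' b c + J a b c * a'.
    exact: jacobiatorM additive skew leibniz _ _ _ _.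
  have JC a b c : J a b c = J b c a by exact: jacobiator_cycle.
  rewrite -/(jacobiator _ _ _ _) -/J.
  apply: (@derivation0 (fun t => J t y z)) => [x' y'|a]; first exact: JM.
  rewrite JC; apply: (@derivation0 (fun t => J t z a%:F)) => [x' y'|b]; first exact: JM.
  rewrite JC; apply: (@derivation0 (fun t => J t a%:F b%:F)) => [x' y'|c]; first exact: JM.
  rewrite /J /jacobiator !frac_bracket_tofrac -!tofracD (pbr_jacobi brP).
  exact: tofrac0.
- exact: leibniz.
Qed.

End FractionBracket.

Section MultivariatePolynomials.

Variables (K : fieldType) (n : nat).
Local Notation A := {mpoly K[n]}.

Lemma mpoly_gen_ind (T : A -> Prop) :
  (forall p q, T p -> T q -> T (p + q)) ->
  (forall p q, T p -> T q -> T (p * q)) ->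
  (forall c, T c%:A) -> (forall i, T 'X_i) -> forall p, T p.
Proof.
move=> TD TM TC TX.
have T0 : T 0 by rewrite -(scale0r 1); exact: TC.
have T1 : T 1 by rewrite -(scale1r 1); exact: TC.
have TXn i k : T ('X_i ^+ k).
  by elim: k => [|k IHk]; rewrite ?expr0 // exprS; apply: TM.
elim/mpolyind=> [//|c m p _ _ IHp]; apply: TD => //.
rewrite -mulr_algl mpolyXE_id; apply: (TM) => //.
apply: big_ind => [||k _]; [exact: T1|exact: TM|exact: TXn].
Qed.

Definition skew_symmetric_mx (lam : 'M[K]_n) : Prop :=
  (forall i j, lam i j = - lam j i) /\ (forall i, lam i i = 0).

Definition affine_bracket (lam : 'M[K]_n) (p q : A) : A :=
  \sum_(i < n) \sum_(j < n) lam i j *: ('X_i * 'X_j * p^`M(i) * q^`M(j)).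

Lemma affine_bracketX lam i j :
  affine_bracket lam 'X_i 'X_j = lam i j *: ('X_i * 'X_j).
Proof.
have dX k l : ('X_k : A)^`M(l) = (k == l)%:R.
  rewrite mderivX mnm1E; case: eqP => [->|_]; last by rewrite scale0r.
  by rewrite -[X in (X - _)%MM]add0m addmK mpolyX0 scale1r.
rewrite /affine_bracket (bigD1 i) //= (bigD1 j) //= !big1.
- by rewrite !dX !eqxx !mulr1 !addr0.
- move=> k /negPf ki; rewrite big1 // => l _.
  by rewrite !dX eq_sym ki mulr0 mul0r scaler0.
- by move=> l /negPf lj; rewrite !dX [j == l]eq_sym lj mulr0 scaler0.
Qed.

Lemma affine_bracket_poisson lam : skew_symmetric_mx lam ->
  poisson_bracket (in_alg A) (affine_bracket lam).
Proof.
move=> [lamC lam0].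
have D p q r : affine_bracket lam (p + q) r
    = affine_bracket lam p r + affine_bracket lam q r.
  rewrite /affine_bracket -big_split; apply: eq_bigr => i _.
  rewrite -big_split; apply: eq_bigr => j _.
  by rewrite mderivD mulrDr mulrDl scalerDr.
have Z c p r : affine_bracket lam (c *: p) r = c *: affine_bracket lam p r.
  rewrite /affine_bracket scaler_sumr; apply: eq_bigr => i _.
  rewrite scaler_sumr; apply: eq_bigr => j _.
  by rewrite mderivZ -scalerAr -scalerAl !scalerA mulrC.
have C p q : affine_bracket lam p q = - affine_bracket lam q p.
  rewrite /affine_bracket exchange_big -sumrN; apply: eq_bigr => i _.
  rewrite -sumrN; apply: eq_bigr => j _.
  by rewrite lamC scaleNr; congr (- (_ *: _)); ring.
have M p q r : affine_bracket lam (p * q) r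
    = p * affine_bracket lam q r + affine_bracket lam p r * q.
  rewrite /affine_bracket mulr_sumr mulr_suml -big_split; apply: eq_bigr => i _.
  rewrite mulr_sumr mulr_suml -big_split; apply: eq_bigr => j _ /=.
  rewrite mderivM -scalerAr -scalerAl -scalerDr; congr (_ *: _); ring.
have Z1 c q : affine_bracket lam c%:A q = 0.
  rewrite /affine_bracket big1 // => i _; rewrite big1 // => j _.
  by rewrite mderivZ -mpolyC1 mderivC scaler0 mulr0 mul0r scaler0.
split.
- by move=> c a b d; rewrite /= !mulr_algl D Z.
- exact: C.
- elim/mpoly_gen_ind=> [p q p0 q0|p q p0 q0|c|i]; last 2 first.
  + exact: Z1.
  + by rewrite affine_bracketX lam0 scale0r.
  + by rewrite D [X in X + _]C [X in _ + X]C !D p0 q0 (C q p); ring.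
  + rewrite M [X in _ * X + _]C [X in _ + X * _]C !M p0 q0 (C q p); ring.
- pose J := jacobiator (affine_bracket lam).
  have JD a a' b c : J (a + a') b c = J a b c + J a' b c.
    exact: jacobiatorD D C _ _ _ _.
  have JM a a' b c : J (a * a') b c = a * J a' b c + J a b c * a'.
    exact: jacobiatorM D C M _ _ _ _.
  have JC a b c : J a b c = J b c a by exact: jacobiator_cycle.
  have Z1' c q : affine_bracket lam q c%:A = 0 by rewrite C Z1 oppr0.
  have Z0 q : affine_bracket lam q 0 = 0 by rewrite -[X in affine_bracket _ _ X](scale0r 1) Z1'.
  have J1 c q r : J c%:A q r = 0.
    by rewrite /J /jacobiator !(Z1, Z1', Z0) !addr0.
  have T i1 i2 i3 : affine_bracket lam 'X_i1 (affine_bracket lam 'X_i2 'X_i3)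
      = (lam i2 i3 * (lam i1 i2 + lam i1 i3)) *: ('X_i1 * 'X_i2 * 'X_i3).
    rewrite affine_bracketX C Z M (C 'X_i3) (C 'X_i2) !affine_bracketX.
    rewrite !mulrN !mulNr -opprD scalerN opprK -scalerA; congr (_ *: _).
    rewrite scalerDl -scalerAr -scalerAl addrC; congr (_ *: _ + _ *: _); ring.
  have JX i j k : J 'X_i 'X_j 'X_k = 0.
    rewrite /J /jacobiator !T.
    rewrite (_ : 'X_i * 'X_j * 'X_k = 'X_k * 'X_i * 'X_j); last by ring.
    rewrite (_ : 'X_j * 'X_k * 'X_i = 'X_k * 'X_i * 'X_j); last by ring.
    rewrite -!scalerDl [X in X *: _](_ : _ = 0) ?scale0r //.
    rewrite (lamC j i) (lamC k i) (lamC k j); ring.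
  move=> p q r; rewrite -/(jacobiator _ _ _ _) -/J.
  elim/mpoly_gen_ind: p => [p p' h h'|p p' h h'|c|i]; last 2 first.
  + exact: J1.
  + rewrite JC; elim/mpoly_gen_ind: q => [p p' h h'|p p' h h'|c|j]; last 2 first.
    * exact: J1.
    * rewrite JC; elim/mpoly_gen_ind: r => [p p' h h'|p p' h h'|c|k]; last 2 first.
      ** exact: J1.
      ** exact: JX.
      ** by rewrite JD h h' addr0.
      ** by rewrite JM h h' mulr0 mul0r addr0.
    * by rewrite JD h h' addr0.
    * by rewrite JM h h' mulr0 mul0r addr0.
  + by rewrite JD h h' addr0.
  + by rewrite JM h h' mulr0 mul0r addr0.
- exact: M.
Qed.

End MultivariatePolynomials.

Section PoissonDerivations.

Variables (K : fieldType) (A : comAlgType K) (br : A -> A -> A).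

(* Maps defined on a subalgebra S of A are represented by functions on A, only
   constrained on S. *)
Variable S : {pred A}.

Definition linear_on (f : A -> A) : Prop :=
  {in S, forall a, f a \in S} /\
  (forall c, {in S &, forall a b, f (c *: a + b) = c *: f a + f b}).

Definition derivation_on (f : A -> A) : Prop :=
  linear_on f /\ {in S &, forall a b, f (a * b) = f a * b + a * f b}.

Definition poisson_derivation_on (alpha : A -> A) : Prop :=
  derivation_on alpha /\
  {in S &, forall a b, alpha (br a b) = br (alpha a) b + br a (alpha b)}.

Definition poisson_skew_derivation_on (alpha delta : A -> A) : Prop :=
  derivation_on delta /\
  {in S &, forall a b,
     delta (br a b) = br (delta a) b + br a (delta b)
                      + alpha a * delta b - delta a * alpha b}.

Definition higher_derivation_on (D : nat -> A -> A) : Prop :=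
  [/\ forall k, linear_on (D k),
      {in S, forall a, D 0 a = a} &
      forall m, {in S &, forall a b,
        D m (a * b) = \sum_(i < m.+1) D i a * D (m - i)%N b}].

Definition iterative_on (D : nat -> A -> A) : Prop :=
  forall i j, {in S, forall a, D i (D j a) = D (i + j)%N a *+ 'C(i + j, i)}.

Definition locally_nilpotent_on (D : nat -> A -> A) : Prop :=
  {in S, forall a, exists m, forall i, (m <= i)%N -> D i a = 0}.

Definition higher_skew_poisson_on (eta : K) (alpha : A -> A)
    (D : nat -> A -> A) : Prop :=
  [/\ higher_derivation_on D,
      forall m, {in S &, forall a b,
        D m (br a b) = \sum_(i < m.+1)
          (br (D i a) (D (m - i)%N b)
           + (alpha (D (m - i)%N a) * D i b
              - D i a * alpha (D (m - i)%N b)) *+ i)} &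
      forall i, {in S, forall a,
        D i (alpha a) = alpha (D i a) + (i%:R * eta) *: D i a}].

End PoissonDerivations.

Section IteratedPoissonOre.

Variables (K : fieldType) (n : nat).
Local Notation A := {mpoly K[n]}.

(* The subalgebra K[X_j : j < i] of K[X_0, ..., X_(n-1)]. *)
Definition vars_below (i : nat) : {pred A} :=
  fun p => all (fun m : 'X_{1..n} =>
                  [forall j : 'I_n, (i <= j)%N ==> (m j == 0%N)]) (msupp p).

(* With variables numbered from 0, the algebra
   K[X_0][X_1; alpha_1, delta_1]_P ... [X_(n-1); alpha_(n-1), delta_(n-1)]_P is
   K[X_0, ..., X_(n-1)] with the bracket br; its i-th stage is vars_below i, and
   alpha i, delta i are irrelevant for i = 0. *)
Record iterated_poisson_ore (br : A -> A -> A) (alpha delta : 'I_n -> A -> A) :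
    Prop := IteratedPoissonOre {
  ipo_poisson : poisson_bracket (in_alg A) br;
  ipo_stage0 : {in vars_below 1 &, forall a b, br a b = 0};
  ipo_closed : forall i, {in vars_below i &, forall a b, br a b \in vars_below i};
  ipo_alpha : forall i : 'I_n, (0 < i)%N ->
    poisson_derivation_on br (vars_below i) (alpha i);
  ipo_delta : forall i : 'I_n, (0 < i)%N ->
    poisson_skew_derivation_on br (vars_below i) (alpha i) (delta i);
  ipo_bracket : forall i : 'I_n, (0 < i)%N ->
    {in vars_below i, forall a, br 'X_i a = alpha i a * 'X_i + delta i a}
}.

End IteratedPoissonOre.

Section TorusAction.

Variables (K : fieldType) (r : nat).

Definition torus : {pred 'rV[K]_r} := fun h => [forall i, h 0 i != 0].
Definition torus_one : 'rV[K]_r := const_mx 1.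
Definition torus_mul (h g : 'rV[K]_r) : 'rV[K]_r := \row_i (h 0 i * g 0 i).

(* A homomorphism to the multiplicative group which is a regular function on the
   torus, that is, a Laurent polynomial in the coordinates. *)
Definition rational_character (chi : 'rV[K]_r -> K) : Prop :=
  [/\ {in torus, forall h, chi h != 0},
      {in torus &, forall h g, chi (torus_mul h g) = chi h * chi g} &
      exists (p : {mpoly K[r]}) (N : nat), {in torus, forall h,
        chi h * (\prod_i h 0 i) ^+ N = p.@[fun i => h 0 i]}].

Variables (A : comAlgType K) (act : 'rV[K]_r -> A -> A).

Definition eigenspace (chi : 'rV[K]_r -> K) (a : A) : Prop :=
  {in torus, forall h, act h a = chi h *: a}.

Record rational_poisson_action (br : A -> A -> A) : Prop :=
    RationalPoissonAction {
  rpa_auto : {in torus, forall h,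
    poisson_isomorphism (in_alg A) br (in_alg A) br (act h)};
  rpa_one : forall a, act torus_one a = a;
  rpa_mul : {in torus &, forall h g a, act (torus_mul h g) a = act h (act g a)};
  rpa_span : forall a, exists (m : nat) (chi : 'I_m -> 'rV[K]_r -> K)
      (v : 'I_m -> A),
    (forall k, eigenspace (chi k) (v k)) /\ a = \sum_k v k;
  rpa_direct : forall (m : nat) (chi : 'I_m -> 'rV[K]_r -> K) (v : 'I_m -> A),
    (forall k l, k != l -> exists2 h, h \in torus & chi k h != chi l h) ->
    (forall k, eigenspace (chi k) (v k)) -> \sum_k v k = 0 ->
    forall k, v k = 0;
  rpa_rational : forall chi a, a != 0 -> eigenspace chi a ->
    rational_character chi
}.

Definition torus_invariant (I : {pred A}) : Prop :=
  {in torus, forall h a, a \in I <-> exists2 b, b \in I & act h b = a}.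

End TorusAction.

Arguments torus : clear implicits.

(* The algebra endomorphism Y_i |-> mu_i Y_i. *)
Definition diagonal_map (K : fieldType) (n : nat) (mu : 'I_n -> K)
    (p : {mpoly K[n]}) : {mpoly K[n]} :=
  p \mPo [tuple mu i *: 'X_i | i < n].

Definition frac_isomorphic (K : fieldType) (n : nat)
    (brA brB : {mpoly K[n]} -> {mpoly K[n]} -> {mpoly K[n]}) : Prop :=
  poisson_isomorphic
    (@tofrac {mpoly K[n]} \o in_alg {mpoly K[n]}) (frac_bracket brA)
    (@tofrac {mpoly K[n]} \o in_alg {mpoly K[n]}) (frac_bracket brB).

Definition frac_quot_isomorphic (K : fieldType) (n : nat)
    (brA : {mpoly K[n]} -> {mpoly K[n]} -> {mpoly K[n]})
    (P : prime_idealr {mpoly K[n]})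
    (brB : {mpoly K[n]} -> {mpoly K[n]} -> {mpoly K[n]})
    (Q : prime_idealr {mpoly K[n]}) : Prop :=
  poisson_isomorphic
    (@tofrac {ideal_quot P} \o \pi_{ideal_quot P} \o in_alg {mpoly K[n]})
    (frac_bracket (@quot_bracket _ brA P))
    (@tofrac {ideal_quot Q} \o \pi_{ideal_quot Q} \o in_alg {mpoly K[n]})
    (frac_bracket (@quot_bracket _ brB Q)).

(* Main.v *)
From HB Require Import structures.
Require Import Defs.
From mathcomp Require Import all_boot all_algebra.
From mathcomp Require Import ring_quotient generic_quotient fraction mpoly.
From mathcomp Require Import ring boolp.

(* A point h : 'I_n -> L of a Poisson field L encodes the algebra map A -> L
   sending X_i to h i. The derivations delta_j are deleted one at a time, from
   the last to the first: if h j = 0 there is nothing to do, and otherwise each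
   h i with i < j is replaced by the image of sum_k D_{j,k}(X_i) t^k, where
   t = 1 / (eta_j h_j). Since eta_j t h_j = 1, the new values satisfy
   {h j, h i} = lambda_{ji} h j h i, and a -> sum_k D_{j,k}(a) t^k is a Poisson
   map on the (j-1)-st subalgebra. The substitution with -t is the inverse one,
   so the values still generate L, and inclusions between kernels are preserved.
   Starting from L = Frac(A / P), the final point is a Poisson map from the
   affine space B to L which generates L; Q is its kernel. *)

Set Implicit Arguments.
Unset Strict Implicit.
Unset Printing Implicit Defensive.

Import GRing.Theory.
Local Open Scope ring_scope.

(** * The subalgebras K[X_j : j < i] and induction over them *)

Section VarsBelow.

Variables (K : fieldType) (n : nat).
Local Notation A := {mpoly K[n]}.
Implicit Types (i : nat) (p q : A).

Lemma vars_belowP i p :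
  reflect (forall (m : 'X_{1..n}) (k : 'I_n), m \in msupp p -> (i <= k)%N -> m k = 0)
    (p \in vars_below i).
Proof.
apply: (iffP allP) => [h m k /h /forallP/(_ k)/implyP h1 /h1/eqP //|h m hm].
by apply/forallP => k; apply/implyP => ik; apply/eqP/h.
Qed.

Lemma vars_belowD i : {in vars_below i &, forall p q, p + q \in vars_below i}.
Proof.
move=> p q /vars_belowP hp /vars_belowP hq; apply/vars_belowP => m k.
by move=> /msuppD_le; rewrite mem_cat => /orP[/hp|/hq]; apply.
Qed.

Lemma vars_belowM i : {in vars_below i &, forall p q, p * q \in vars_below i}.
Proof.
move=> p q /vars_belowP hp /vars_belowP hq; apply/vars_belowP => m k.
move=> /msuppM_le /allpairsP[[m1 m2] /= [h1 h2 ->]] ik.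
by rewrite mnmDE (hp _ _ h1 ik) (hq _ _ h2 ik).
Qed.

Lemma vars_belowA i (c : K) : c%:A \in @vars_below K n i.
Proof.
apply/vars_belowP => m k; rewrite -mul_mpolyC mulr1 msuppC.
by case: ifP => // _; rewrite inE => /eqP -> _; rewrite mnm0E.
Qed.

Lemma vars_belowX i (k : 'I_n) : (k < i)%N -> 'X_k \in @vars_below K n i.
Proof.
move=> ki; apply/vars_belowP => m l; rewrite msuppX inE => /eqP -> il.
by rewrite mnm1E; case: eqP ki => // ->; rewrite ltnNge il.
Qed.

Lemma vars_below0 i : 0 \in @vars_below K n i.
Proof. by rewrite -(scale0r 1) vars_belowA. Qed.

Lemma vars_below1 i : 1 \in @vars_below K n i.
Proof. by rewrite -(scale1r 1) vars_belowA. Qed.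

Lemma vars_below_le i k : (i <= k)%N -> {subset @vars_below K n i <= vars_below k}.
Proof.
move=> ik p /vars_belowP hp; apply/vars_belowP => m l /hp h kl.
by apply: h; apply: leq_trans kl.
Qed.

Lemma vars_below_full p : p \in vars_below n.
Proof.
by apply/vars_belowP => m k _; rewrite leqNgt ltn_ord.
Qed.

(** Every monomial in the support of [p] involves only variables of index below [i]. The closure
    conditions are restricted to the subalgebra so that [T] may speak of maps constrained only
    there. *)
Lemma vars_below_ind i (T : A -> Prop) :
  {in vars_below i &, forall p q, T p -> T q -> T (p + q)} ->
  {in vars_below i &, forall p q, T p -> T q -> T (p * q)} ->
  (forall c, T c%:A) -> (forall k : 'I_n, (k < i)%N -> T 'X_k) ->
  {in vars_below i, forall p, T p}.
Proof.
move=> TD TM TC TX p /vars_belowP hp.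
pose U q := q \in vars_below i /\ T q.
have UD q r : U q -> U r -> U (q + r).
  by case=> ? ? [? ?]; split; [exact: vars_belowD|exact: TD].
have UM q r : U q -> U r -> U (q * r).
  by case=> ? ? [? ?]; split; [exact: vars_belowM|exact: TM].
have UC c : U c%:A by split; [exact: vars_belowA|exact: TC].
have U0 : U 0 by rewrite -(scale0r 1).
have U1 : U 1 by rewrite -(scale1r 1).
suff: U p by case.
rewrite [p]mpolyE big_seq; apply: big_ind; [exact: U0|exact: UD|move=> m mp].
rewrite -mulr_algl; apply: (UM) => //; rewrite mpolyXE_id.
apply: big_ind; [exact: U1|exact: UM|move=> k _].
have [ki|ik] := ltnP k i; last by rewrite (hp m k) ?expr0.
have UX : U 'X_k by split; [exact: vars_belowX|exact: TX].
by elim: (m k) => [|l IH]; rewrite ?expr0 // exprS; exact: UM.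
Qed.

Lemma derivation_on_scalar i (f : A -> A) : derivation_on (vars_below i) f ->
  forall c, f c%:A = 0.
Proof.
move=> [[_ lin] leib] c; have S1 := vars_below1 i; have S0 := vars_below0 i.
have e1 : f 1 = 0.
  have := leib 1 1 S1 S1; rewrite !mulr1 mul1r => e.
  by apply: (addrI (f 1)); rewrite -e addr0.
have e0 : f 0 = 0.
  have := lin 1 0 0 S0 S0; rewrite !scale1r addr0 => e.
  by apply: (addrI (f 0)); rewrite -e addr0.
by rewrite -[c%:A]addr0 lin // e1 e0 scaler0 addr0.
Qed.

End VarsBelow.

(** * Points of a field and the evaluation maps they define *)

Section Evaluation.

Variables (K : fieldType) (n : nat) (L : fieldType) (iL : {rmorphism K -> L}).
Local Notation A := {mpoly K[n]}.
Implicit Type h : 'I_n -> L.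

Lemma mmap_var h i : mmap iL h 'X_i = h i.
Proof. by rewrite mmapX mmap1U. Qed.

Lemma mmapA h c : mmap iL h c%:A = iL c.
Proof. by rewrite mmapZ rmorph1 mulr1. Qed.

Lemma mmapM h : {morph mmap iL h : p q / p * q}.
Proof. exact: rmorphM. Qed.

Lemma mmap_1 h : mmap iL h 1 = 1.
Proof. exact: rmorph1. Qed.

Lemma mmapXn h p k : mmap iL h (p ^+ k) = mmap iL h p ^+ k.
Proof. exact: rmorphXn. Qed.

Lemma mmap_below_eq (i : nat) h h' : (forall k : 'I_n, (k < i)%N -> h k = h' k) ->
  {in vars_below i, mmap iL h =1 mmap iL h'}.
Proof.
move=> e; apply: vars_below_ind => [p q _ _ hp hq|p q _ _ hp hq|c|k /e].
- by rewrite !mmapD hp hq.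
- by rewrite !mmapM hp hq.
- by rewrite !mmapA.
- by rewrite !mmap_var.
Qed.

Lemma mmap_eq h h' : h =1 h' -> mmap iL h =1 mmap iL h'.
Proof.
by move=> e p; apply: (mmap_below_eq (i := n)) (vars_below_full p) => k _.
Qed.

Lemma mmap_rmorph (phi : {rmorphism A -> L}) : (forall c, phi c%:A = iL c) ->
  forall p, mmap iL (fun i => phi 'X_i) p = phi p.
Proof.
move=> phiA; elim/mpoly_gen_ind=> [p q ep eq|p q ep eq|c|i].
- by rewrite mmapD ep eq rmorphD.
- by rewrite mmapM ep eq rmorphM.
- by rewrite mmapA.
- by rewrite mmap_var.
Qed.

(** The field L is generated over K by the values [h i]. *)
Definition generates h : Prop :=
  forall x : L, exists a b : A, mmap iL h b != 0 /\ x = mmap iL h a / mmap iL h b.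

(** The quotients of values at [h'] form a subfield containing K; once it contains each [h i], it
    contains all quotients of values at [h]. *)
Lemma generates_trans h h' : generates h ->
  (forall i, exists a b : A,
     mmap iL h' b != 0 /\ h i = mmap iL h' a / mmap iL h' b) ->
  generates h'.
Proof.
move=> gen var.
pose T x := exists a b : A, mmap iL h' b != 0 /\ x = mmap iL h' a / mmap iL h' b.
have TM x y : T x -> T y -> T (x * y).
  case=> [a [b [b0 ->]]] [a' [b' [b'0 ->]]]; exists (a * a'), (b * b').
  by rewrite !mmapM mulf_neq0 // mulf_div.
have TV x : T x -> T x^-1.
  case=> [a [b [b0 ->]]].
  (* A vanishing numerator gives x = 0, whose inverse is 0 by convention and is represented by 0 /
     1. *)
  have [a0|a0] := eqVneq (mmap iL h' a) 0.
    by exists 0, 1; rewrite mmap_1 oner_neq0 a0 mmap0 !mul0r invr0.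
  by exists b, a; rewrite a0 invf_div.
have Tphi p : T (mmap iL h p).
  elim/mpoly_gen_ind: p => [p q|p q|c|i].
  - case=> [a [b [b0 e]]] [a' [b' [b'0 e']]]; exists (a * b' + a' * b), (b * b').
    by rewrite !mmapD !mmapM mulf_neq0 // e e' addf_div.
  - by rewrite mmapM; apply: TM.
  - by exists c%:A, 1; rewrite mmap_1 oner_neq0 !mmapA divr1.
  - by rewrite mmap_var.
by move=> x; have [a [b [_ ->]]] := gen x; apply: TM => //; apply: TV.
Qed.

End Evaluation.

(** * Diagonal endomorphisms as rescalings of points *)

Section DiagonalMap.

Variables (K : fieldType) (n : nat).
Implicit Types (mu nu : 'I_n -> K) (p q : {mpoly K[n]}).

Lemma diagonal_mapD mu : {morph diagonal_map mu : p q / p + q}.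
Proof. exact: comp_mpolyD. Qed.

Lemma diagonal_mapM mu : {morph diagonal_map mu : p q / p * q}.
Proof. exact: (rmorphM (comp_mpoly _)). Qed.

Lemma diagonal_mapZ mu c : {morph diagonal_map mu : p / c *: p}.
Proof. by move=> p; exact: comp_mpolyZ. Qed.

Lemma diagonal_mapA mu c : diagonal_map mu c%:A = c%:A.
Proof. by rewrite diagonal_mapZ /diagonal_map (rmorph1 (comp_mpoly _)). Qed.

Lemma diagonal_mapX mu i : diagonal_map mu 'X_i = mu i *: 'X_i.
Proof. by rewrite /diagonal_map comp_mpolyXU -tnth_nth tnth_mktuple. Qed.

Lemma diagonal_mapK mu nu : (forall i, nu i * mu i = 1) ->
  cancel (diagonal_map mu) (diagonal_map nu).
Proof.
move=> munu; elim/mpoly_gen_ind=> [p q ep eq|p q ep eq|c|i].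
- by rewrite !diagonal_mapD ep eq.
- by rewrite !diagonal_mapM ep eq.
- by rewrite !diagonal_mapA.
- by rewrite diagonal_mapX diagonal_mapZ diagonal_mapX scalerA mulrC munu scale1r.
Qed.

Lemma mmap_diagonal (L : fieldType) (iL : {rmorphism K -> L}) mu (h : 'I_n -> L) p :
  mmap iL h (diagonal_map mu p) = mmap iL (fun i => iL (mu i) * h i) p.
Proof.
elim/mpoly_gen_ind: p => [p q ep eq|p q ep eq|d|l].
- by rewrite diagonal_mapD !mmapD ep eq.
- by rewrite diagonal_mapM !mmapM ep eq.
- by rewrite diagonal_mapA !mmapA.
- by rewrite diagonal_mapX mmapZ !mmap_var.
Qed.

End DiagonalMap.

(** * The substitution defined by a higher derivation, and its inverse *)

Section Shift.

Variables (K : fieldType) (n : nat) (j : 'I_n).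
Local Notation A := {mpoly K[n]}.
Local Notation S := (@vars_below K n j).
Variable D : nat -> A -> A.
Hypothesis D_higher : higher_derivation_on S D.
Hypothesis D_nilp : locally_nilpotent_on S D.

(** A bound chosen classically; the default 0 can only occur outside [S], where local nilpotence is
    not assumed. *)
Definition nilpotency_bound (a : A) : nat :=
  if pselect (exists m, forall i, (m <= i)%N -> D i a = 0) is left h
  then projT1 (cid h) else 0.

Lemma nilpotency_boundP a k : a \in S -> (nilpotency_bound a <= k)%N -> D k a = 0.
Proof.
move=> aS; rewrite /nilpotency_bound; case: pselect => [h|[]]; last exact: D_nilp.
exact: (projT2 (cid h)).
Qed.

Lemma higher_stable k : {in S, forall a, D k a \in S}.
Proof. by case: D_higher => /(_ k)[h _] _ _. Qed.

Lemma higher_linear k c : {in S &, forall a b, D k (c *: a + b) = c *: D k a + D k b}.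
Proof. by case: D_higher => /(_ k)[_ h] _ _; apply: h. Qed.

Lemma higherD k : {in S &, forall a b, D k (a + b) = D k a + D k b}.
Proof. by move=> a b aS bS; rewrite -[a]scale1r higher_linear // !scale1r. Qed.

Lemma higher0 k : D k 0 = 0.
Proof.
have S0 := vars_below0 K n j.
by apply: (addrI (D k 0)); rewrite -higherD // !addr0.
Qed.

Lemma higherZ k c : {in S, forall a, D k (c *: a) = c *: D k a}.
Proof.
move=> a aS; have S0 := vars_below0 K n j.
by rewrite -[c *: a]addr0 higher_linear // higher0 addr0.
Qed.

Lemma higher_id : {in S, forall a, D 0 a = a}.
Proof. by case: D_higher. Qed.

Lemma higherM m : {in S &, forall a b,
  D m (a * b) = \sum_(i < m.+1) D i a * D (m - i)%N b}.
Proof. by case: D_higher => _ _ /(_ m). Qed.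

Lemma higher1 k : D k.+1 1 = 0.
Proof.
have S1 := vars_below1 K n j.
elim/ltn_ind: k => k IH.
(* In the expansion of [D k.+1 (1 * 1)] the middle terms vanish by induction, and the two end terms
   both equal [D k.+1 1]. *)
have := higherM k.+1 S1 S1; rewrite mulr1 big_ord_recl big_ord_recr /= subn0 subnn.
rewrite !higher_id // mul1r mulr1 big1 => [|[i ik] _]; last first.
  by rewrite /bump /= IH // mul0r.
by rewrite add0r -[LHS]addr0 => /addrI.
Qed.

Section Point.

Variables (L : fieldType) (iL : {rmorphism K -> L}).
Implicit Type h : 'I_n -> L.

(** The generating series of the values of D_k(a) at [h]. Local nilpotence makes it a polynomial for
    [a] in [S], and the higher Leibniz rule makes it multiplicative there. *)
Definition dpoly h (a : A) : {poly L} :=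
  \poly_(k < nilpotency_bound a) mmap iL h (D k a).

Lemma coef_dpoly h a k : a \in S -> (dpoly h a)`_k = mmap iL h (D k a).
Proof.
move=> aS; rewrite coef_poly; case: ltnP => // /(nilpotency_boundP aS) ->.
by rewrite mmap0.
Qed.

Lemma dpolyD h : {in S &, {morph dpoly h : a b / a + b}}.
Proof.
move=> a b aS bS; apply/polyP => k.
by rewrite coefD !coef_dpoly ?vars_belowD // higherD // mmapD.
Qed.

Lemma dpolyM h : {in S &, {morph dpoly h : a b / a * b}}.
Proof.
move=> a b aS bS; apply/polyP => k.
rewrite coefM coef_dpoly ?vars_belowM // higherM // raddf_sum /=.
by apply: eq_bigr => i _; rewrite !coef_dpoly // mmapM.
Qed.

Lemma dpolyA h c : dpoly h c%:A = (iL c)%:P.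
Proof.
have S1 := vars_below1 K n j.
apply/polyP => k; rewrite coef_dpoly ?vars_belowA // coefC higherZ //.
by case: k => [|k]; rewrite ?higher_id ?mmapA // higher1 scaler0 mmap0.
Qed.

(** The scalar [c] is left free because deletion uses c = 1 / eta and its inverse uses -c. The
    coordinate [h j] is kept, so both shifts have the same denominator. *)
Definition shift (c : K) h : 'I_n -> L :=
  fun i => if (i < j)%N then (dpoly h 'X_i).[iL c / h j] else h i.

Lemma shift_ge c h (i : 'I_n) : (j <= i)%N -> shift c h i = h i.
Proof. by rewrite /shift ltnNge => ->. Qed.

Lemma shift_lt c h (i : 'I_n) : (i < j)%N ->
  shift c h i = (dpoly h 'X_i).[iL c / h j].
Proof. by rewrite /shift => ->. Qed.

Lemma mmap_shift c h : {in S, forall a,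
  mmap iL (shift c h) a = (dpoly h a).[iL c / h j]}.
Proof.
apply: vars_below_ind => [a b aS bS ea eb|a b aS bS ea eb|d|i ij].
- by rewrite mmapD dpolyD // hornerD ea eb.
- by rewrite mmapM dpolyM // hornerM ea eb.
- by rewrite mmapA dpolyA hornerC.
- by rewrite mmap_var shift_lt.
Qed.

Hypothesis D_iter : iterative_on S D.

(** The binomial coefficient in D_i D_k = binom(i + k, i) D_{i+k} is the one in the k-th divided
    derivative of a polynomial. *)
Lemma dpoly_higher h k : {in S, forall a, dpoly h (D k a) = (dpoly h a)^`N(k)}.
Proof.
move=> a aS; apply/polyP => i.
rewrite coef_nderivn !coef_dpoly ?higher_stable // D_iter // raddfMn /= addnC.
by rewrite -bin_sub ?leq_addl // addnK.
Qed.

Lemma shiftK c h : shift (- c) (shift c h) =1 h.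
Proof.
move=> i; have [ij|ji] := ltnP i j; last by rewrite !shift_ge.
have XS := vars_belowX K ij.
rewrite shift_lt // shift_ge // rmorphN mulNr; set t := iL c / h j.
(* The second shift evaluates at -t the series whose coefficients are the divided derivatives of
   [dpoly] at t; by Taylor's formula this is the value at t - t = 0. *)
rewrite horner_poly; transitivity (dpoly h 'X_i).[t - t].
  rewrite (@nderiv_taylor_wide _ (nilpotency_bound 'X_i));
    [|exact: mulrC|exact: size_poly].
  by apply: eq_bigr => k _; rewrite mmap_shift ?higher_stable // dpoly_higher.
by rewrite subrr horner_coef0 coef_dpoly // higher_id // mmap_var.
Qed.

End Point.

(** Powers of [h j] clear the denominators. The exponent and the polynomial [q] are independent of
    the field and of the point, which allows different points to be compared. *)
Lemma mmap_shift_numerator (c : K) (p : A) : exists (N : nat) (q : A),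
  forall (L : fieldType) (iL : {rmorphism K -> L}) (h : 'I_n -> L), h j != 0 ->
    h j ^+ N * mmap iL (shift iL c h) p = mmap iL h q.
Proof.
elim/mpoly_gen_ind: p => [p1 p2|p1 p2|d|i].
- move=> [N1 [q1 e1]] [N2 [q2 e2]]; exists (N1 + N2)%N.
  exists ('X_j ^+ N2 * q1 + 'X_j ^+ N1 * q2) => L iL h hj.
  rewrite !mmapD !mmapM !mmapXn mmap_var -e1 // -e2 // exprD; ring.
- move=> [N1 [q1 e1]] [N2 [q2 e2]]; exists (N1 + N2)%N, (q1 * q2) => L iL h hj.
  rewrite !mmapM -e1 // -e2 // exprD; ring.
- by exists 0, d%:A => L iL h _; rewrite !mmapA expr0 mul1r.
- have [ij|ji] := ltnP i j; last first.
    by exists 0, 'X_i => L iL h _; rewrite !mmap_var shift_ge // expr0 mul1r.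
  pose N := nilpotency_bound 'X_i; exists N.
  exists (\sum_(k < N) (c ^+ k)%:A * (D k 'X_i * 'X_j ^+ (N - k))) => L iL h hj.
  rewrite raddf_sum mmap_var shift_lt // horner_poly mulr_sumr /=.
  apply: eq_bigr => [[k kN] _] /=.
  rewrite !mmapM mmapA mmapXn mmap_var rmorphXn.
  have -> : h j ^+ N = h j ^+ (N - k) * h j ^+ k by rewrite -exprD subnK // ltnW.
  rewrite expr_div_n; have := expf_neq0 k hj.
  move: (h j ^+ k) (h j ^+ (N - k)) (iL c ^+ k) => u v w u0; by field.
Qed.

(** The same numerator [q] serves both points: it vanishes at [h], hence at [h'], and the power of
    [h' j] in front can be cancelled. *)
Lemma shift_kernel (c : K) (L L' : fieldType) (iL : {rmorphism K -> L})
    (iL' : {rmorphism K -> L'}) (h : 'I_n -> L) (h' : 'I_n -> L') :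
  h j != 0 -> h' j != 0 ->
  (forall p, mmap iL h p = 0 -> mmap iL' h' p = 0) ->
  forall p, mmap iL (shift iL c h) p = 0 -> mmap iL' (shift iL' c h') p = 0.
Proof.
move=> hj h'j sub p p0; have [N [q e]] := mmap_shift_numerator c p.
have := sub q; rewrite -!e // p0 mulr0 => /(_ erefl)/eqP.
by rewrite mulf_eq0 expf_eq0 (negPf h'j) andbF => /eqP.
Qed.

(** Comparison with the generic point [X] of Frac A. The kernel at [h] is zero, so it lies in the
    kernel at [g], the shift of [X] by [-c]; after shifting both by [c], the second point is [X],
    where only 0 vanishes. *)
Lemma shift_injective (c : K) (L : fieldType) (iL : {rmorphism K -> L})
    (h : 'I_n -> L) : iterative_on S D -> h j != 0 ->
  (forall p, mmap iL h p = 0 -> p = 0) ->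
  forall p, mmap iL (shift iL c h) p = 0 -> p = 0.
Proof.
move=> D_iter hj inj p p0.
pose iF : {rmorphism K -> {fraction A}} := @tofrac A \o in_alg A.
pose X (i : 'I_n) : {fraction A} := ('X_i)%:F.
pose g := shift iF (- c) X.
have gj : g j != 0.
  by rewrite /g shift_ge // tofrac_eq0 -msize_poly_eq0 msizeX mdeg1.
have /eqP := shift_kernel (iL' := iF) (h' := g) hj gj
  (fun q q0 => etrans (congr1 (mmap iF g) (inj q q0)) (mmap0 _ _)) p0.
have gX : shift iF c g =1 X by move=> i; rewrite -[c]opprK shiftK.
rewrite (mmap_eq iF gX) => /eqP.
suff -> : mmap iF X p = p%:F by move/eqP; rewrite tofrac_eq0 => /eqP.
exact: (mmap_rmorph (phi := @tofrac A)).
Qed.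

(** Shifting back by [-c] writes each [h i] as a polynomial in the shifted values divided by a power
    of [h j]. *)
Lemma shift_generates (c : K) (L : fieldType) (iL : {rmorphism K -> L})
    (h : 'I_n -> L) : iterative_on S D -> h j != 0 ->
  generates iL h -> generates iL (shift iL c h).
Proof.
move=> D_iter hj gen; apply: generates_trans gen _ => i.
have [N [q e]] := mmap_shift_numerator (- c) 'X_i.
have sj : shift iL c h j = h j by rewrite shift_ge.
exists q, ('X_j ^+ N); rewrite mmapXn mmap_var -e sj // expf_neq0 //; split=> //.
by rewrite mulrC mulKf ?expf_neq0 // mmap_var shiftK.
Qed.

(** The factor mu_j^k in the weight of D_k(X_i) cancels the factor mu_j^(-k) acquired by the k-th
    power of c / h_j. *)
Lemma shift_scale (c : K) (L : fieldType) (iL : {rmorphism K -> L})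
    (h : 'I_n -> L) (mu : 'I_n -> K) :
  mu j != 0 ->
  (forall (i : 'I_n) k, (i < j)%N ->
     diagonal_map mu (D k 'X_i) = (mu j ^+ k * mu i) *: D k 'X_i) ->
  shift iL c (fun i => iL (mu i) * h i) =1 (fun i => iL (mu i) * shift iL c h i).
Proof.
move=> muj eigen i; have [ij|ji] := ltnP i j; last by rewrite !shift_ge.
rewrite !shift_lt // !horner_poly mulr_sumr; apply: eq_bigr => k _.
rewrite -mmap_diagonal eigen // mmapZ rmorphM rmorphXn.
have mu0 : iL (mu j) != 0 by rewrite fmorph_eq0.
(* If h_j = 0 then c / h_j is 0 by convention and only the term k = 0 survives. *)
have [->|hj] := eqVneq (h j) 0.
  rewrite mulr0 invr0 mulr0; case: (nat_of_ord k) => [|l]; rewrite ?expr0n /= ?mulr0 //.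
  by rewrite !expr0; ring.
rewrite !expr_div_n exprMn; field.
by rewrite !expf_neq0.
Qed.

End Shift.

(** * Poisson brackets of values of polynomials *)

Lemma coef_sum_bilinear (R : nzRingType) (f : R -> R -> R) (p q : {poly R}) m :
  (forall x, f 0 x = 0) -> (forall x, f x 0 = 0) ->
  (\sum_(k < size p) \sum_(l < size q) f p`_k q`_l *: 'X^(k + l))`_m
    = \sum_(k < m.+1) f p`_k q`_(m - k).
Proof.
move=> f0x fx0; rewrite coef_sum.
have inner (k : 'I_(size p)) :
    (\sum_(l < size q) f p`_k q`_l *: 'X^(k + l))`_m
      = if (k < m.+1)%N then f p`_k q`_(m - k) else 0.
  rewrite coef_sum; under eq_bigr do rewrite coefZ coefXn.
  rewrite ltnS; case: leqP => km; last first.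
    rewrite big1 // => l _; case: eqP => [e|_]; last by rewrite mulr0.
    by rewrite e ltnNge leq_addr in km.
  have [sq|qs] := ltnP (m - k) (size q).
    rewrite (bigD1 (Ordinal sq)) //= subnKC // eqxx mulr1 big1 ?addr0 // => l.
    move=> /eqP ne; case: eqP => [e|_]; last by rewrite mulr0.
    by case: ne; apply: val_inj; rewrite /= e addKn.
  rewrite [q`_(m - k)]nth_default // fx0 big1 // => l _.
  case: eqP => [e|_]; last by rewrite mulr0.
  by have := ltn_ord l; rewrite ltnNge => /negP[]; rewrite e addKn in qs.
rewrite (eq_bigr _ (fun k _ => inner k)) -big_mkcond.
(* Both sums are extended to one common range; terms beyond [size p] vanish because [f 0 x = 0]. *)
rewrite (big_ord_widen_cond (maxn (size p) m.+1) (fun k => k < m.+1)%N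
  (fun k => f p`_k q`_(m - k))) ?leq_maxl //.
rewrite [RHS](big_ord_widen (maxn (size p) m.+1)
  (fun k => f p`_k q`_(m - k))) ?leq_maxr //.
rewrite [LHS]big_mkcond [RHS]big_mkcond; apply: eq_bigr => k _.
case: (k < m.+1)%N => //=; case: ltnP => // sk.
by rewrite [p`_k]nth_default // f0x.
Qed.

Lemma horner_deriv_sum (R : comNzRingType) (p : {poly R}) t :
  p^`().[t] = \sum_(k < size p) p`_k *+ k * t ^+ k.-1.
Proof.
rewrite /deriv horner_poly; case: (size p) => [|s]; first by rewrite !big_ord0.
by rewrite big_ord_recl mulr0n mul0r add0r.
Qed.

Section BracketHorner.

Variables (K L : fieldType) (iL : {rmorphism K -> L}) (brL : L -> L -> L).
Hypothesis brP : poisson_bracket iL brL.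

Lemma bracket_sum (I : finType) (F : I -> L) y :
  brL (\sum_i F i) y = \sum_i brL (F i) y.
Proof.
apply: (big_morph (brL^~ y)) => [u v|]; [exact: (pbrD brP)|exact: (pbr0 brP)].
Qed.

Lemma bracketX t k y : brL (t ^+ k) y = t ^+ k.-1 *+ k * brL t y.
Proof.
elim: k => [|k IH]; first by rewrite expr0 mulr0n mul0r -(rmorph1 iL) (pbr_scalar brP).
rewrite exprS (pbr_leibniz brP) IH; case: k {IH} => [|k] /=; first by rewrite !expr0; ring.
by rewrite [in RHS]mulrSr exprS; ring.
Qed.

Lemma bracket_hornerl (p : {poly L}) t y :
  brL p.[t] y = \sum_(k < size p) brL p`_k y * t ^+ k + p^`().[t] * brL t y.
Proof.
rewrite horner_coef bracket_sum horner_deriv_sum mulr_suml -big_split.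
by apply: eq_bigr => k _; rewrite (pbr_leibniz brP) bracketX /=; ring.
Qed.

(** Leibniz expansion in the coefficients and in [t]; the contribution of {t, t} vanishes. *)
Lemma bracket_horner (p q : {poly L}) t :
  brL p.[t] q.[t] =
    (\sum_(k < size p) \sum_(l < size q) brL p`_k q`_l *: 'X^(k + l)).[t]
    + p^`().[t] * \sum_(l < size q) brL t q`_l * t ^+ l
    - q^`().[t] * \sum_(k < size p) brL t p`_k * t ^+ k.
Proof.
have bracket_hornerr x : brL x q.[t] =
    \sum_(l < size q) brL x q`_l * t ^+ l - q^`().[t] * brL t x.
  rewrite (pbr_skew brP) bracket_hornerl opprD -sumrN; congr (_ - _).
  by apply: eq_bigr => l _; rewrite (pbr_skew brP x) mulNr.
rewrite bracket_hornerl (bracket_hornerr t) (pbr_alternating brP) mulr0 subr0.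
rewrite addrAC; congr (_ + _); rewrite horner_sum mulr_sumr -sumrB.
apply: eq_bigr => k _; rewrite horner_sum bracket_hornerr mulrBl mulr_suml.
congr (_ - _); last by rewrite mulrA.
by apply: eq_bigr => l _; rewrite hornerZ hornerXn exprD; ring.
Qed.

End BracketHorner.

(** * The shifted evaluation is a Poisson map and straightens the bracket with h_j *)

Section ShiftBracket.

Variables (K : fieldType) (n : nat) (j : 'I_n).
Local Notation A := {mpoly K[n]}.
Local Notation S := (@vars_below K n j).
Variables (br : A -> A -> A) (alpha delta : A -> A) (D : nat -> A -> A) (eta : K).
Hypothesis br_closed : {in S &, forall a b, br a b \in S}.
Hypothesis alpha_der : derivation_on S alpha.
Hypothesis bracket_top : {in S, forall a, br 'X_j a = alpha a * 'X_j + delta a}.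
Hypothesis D1 : {in S, forall a, D 1%N a = delta a}.
Hypothesis D_skew : higher_skew_poisson_on br S eta alpha D.
Hypothesis D_nilp : locally_nilpotent_on S D.
Hypothesis D_iter : iterative_on S D.
Hypothesis eta_neq0 : eta != 0.

Variables (L : fieldType) (iL : {rmorphism K -> L}) (brL : L -> L -> L).
Hypothesis brP : poisson_bracket iL brL.
Variable h : 'I_n -> L.
Hypothesis hj : h j != 0.
Hypothesis mmap_br : {in vars_below j.+1 &, forall a b,
  mmap iL h (br a b) = brL (mmap iL h a) (mmap iL h b)}.

Let D_higher : higher_derivation_on S D. Proof. by case: D_skew. Qed.
Let sub_succ : {subset S <= vars_below j.+1}. Proof. exact: vars_below_le. Qed.
Let XjS : 'X_j \in @vars_below K n j.+1. Proof. exact: vars_belowX. Qed.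

Local Notation phi := (mmap iL h).
Local Notation t := (iL eta^-1 / h j).
Local Notation h' := (shift j D iL eta^-1 h).
Local Notation dp := (dpoly D iL h).

Let alpha_stable a : a \in S -> alpha a \in S.
Proof. by case: alpha_der => [[h1 _] _]; apply: h1. Qed.

Let alpha0 : alpha 0 = 0.
Proof. by have := derivation_on_scalar alpha_der 0; rewrite scale0r. Qed.

Let eta_t : iL eta * t * h j = 1.
Proof. by rewrite fmorphV; field; rewrite hj fmorph_eq0. Qed.

Lemma bracket_var_mmap : {in S, forall a,
  brL (h j) (phi a) = phi (alpha a) * h j + phi (D 1%N a)}.
Proof.
move=> a aS; rewrite D1 // -(mmap_var iL h j) -(mmap_br XjS (sub_succ aS)).
by rewrite bracket_top // mmapD mmapM.
Qed.

(** The product t h_j is the scalar 1 / eta, so {t h_j, phi a} = 0 determines {t, phi a}; the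
    relation eta t h_j = 1 then removes h_j from the formula. *)
Lemma bracket_inv_mmap : {in S, forall a,
  brL t (phi a) = - t * (phi (alpha a) + iL eta * t * phi (D 1%N a))}.
Proof.
move=> a aS; apply: (mulIf hj); apply: (addrI (t * brL (h j) (phi a))).
rewrite -(pbr_leibniz brP) divfK // (pbr_scalar brP) bracket_var_mmap //.
transitivity (t * phi (D 1%N a) * (1 - iL eta * t * h j)); last by ring.
by rewrite eta_t; ring.
Qed.

(** The analogue of [dp a] with [alpha] applied before evaluating each coefficient. *)
Let apoly a := \poly_(k < nilpotency_bound D a) phi (alpha (D k a)).

Let coef_apoly a k : a \in S -> (apoly a)`_k = phi (alpha (D k a)).
Proof.
move=> aS; rewrite coef_poly; case: ltnP => // /(nilpotency_boundP D_nilp aS) ->.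
by rewrite alpha0 mmap0.
Qed.

Let size_dpoly a : (size (dp a) <= nilpotency_bound D a)%N.
Proof. exact: size_poly. Qed.

Let coef_deriv_dpoly a k : a \in S -> (dp a)^`()`_k = phi (D 1%N (D k a)).
Proof.
move=> aS; rewrite coef_deriv (coef_dpoly D_nilp) // D_iter // add1n bin1.
by rewrite raddfMn.
Qed.

Let sum_bracket_inv a : a \in S ->
  \sum_(k < size (dp a)) brL t (dp a)`_k * t ^+ k
    = - t * ((apoly a).[t] + iL eta * t * (dp a)^`().[t]).
Proof.
move=> aS.
(* The degree of [dp a] may be smaller than the nilpotency bound; the added terms are brackets with
   0. *)
have -> : \sum_(k < size (dp a)) brL t (dp a)`_k * t ^+ k
    = \sum_(k < nilpotency_bound D a) brL t (dp a)`_k * t ^+ k.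
  rewrite (big_ord_widen _ (fun k => brL t (dp a)`_k * t ^+ k) (size_dpoly a)).
  rewrite big_mkcond; apply: eq_bigr => k _; case: ltnP => // sk.
  by rewrite nth_default // (pbr_skew brP) (pbr0 brP) oppr0 mul0r.
rewrite (horner_coef_wide (p := (dp a)^`()) t (n := nilpotency_bound D a)); last first.
  by apply: leq_trans (size_dpoly a); apply/leq_trans/leq_pred; exact: size_poly.
rewrite horner_poly [X in _ + X]mulr_sumr -big_split mulr_sumr /=.
apply: eq_bigr => k _; rewrite (coef_dpoly D_nilp) // coef_deriv_dpoly //.
by rewrite bracket_inv_mmap ?(higher_stable D_higher) //; ring.
Qed.

(** This is the skew Poisson identity for all D_m at once: the integer factor i there is produced by
    the operator X d/dX on generating series. *)
Lemma dpoly_bracket : {in S &, forall a b,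
  dp (br a b) =
    (\sum_(k < size (dp a)) \sum_(l < size (dp b))
       brL (dp a)`_k (dp b)`_l *: 'X^(k + l))
    - 'X * (dp a)^`() * apoly b + 'X * (dp b)^`() * apoly a}.
Proof.
move=> a b aS bS; have DS k c : c \in S -> D k c \in S.
  exact: (higher_stable D_higher).
have coefXd c k : c \in S -> ('X * (dp c)^`())`_k = phi (D k c) *+ k.
  move=> cS; rewrite coefXM; case: k => [|k] //=.
  by rewrite coef_deriv (coef_dpoly D_nilp).
apply/polyP => m; rewrite (coef_dpoly D_nilp) ?br_closed // coefD coefB !coefM.
rewrite coef_sum_bilinear => [|x|x]; first last.
- by rewrite (pbr_skew brP) (pbr0 brP) oppr0.
- exact: (pbr0 brP).
case: D_skew => _ /(_ m) -> // _; rewrite raddf_sum -sumrB -big_split /=.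
apply: eq_bigr => i _; rewrite !coefXd // !coef_apoly // !(coef_dpoly D_nilp) //.
rewrite mmapD raddfMn /= mmapB !mmapM mmap_br ?sub_succ ?DS //.
by rewrite mulrnBl !mulrnAl addrA addrAC [X in _ - _ + X *+ _]mulrC.
Qed.

(** Expanding the bracket of the two values at t gives two opposite terms eta t^2 (dp a)'(t) (dp
    b)'(t); what remains is [dpoly_bracket] evaluated at t. *)
Lemma mmap_shift_bracket : {in S &, forall a b,
  mmap iL h' (br a b) = brL (mmap iL h' a) (mmap iL h' b)}.
Proof.
move=> a b aS bS; rewrite !(mmap_shift D_higher D_nilp) ?br_closed //.
rewrite (bracket_horner brP) !sum_bracket_inv // dpoly_bracket //.
by rewrite !(hornerD, hornerN, hornerM, hornerX); ring.
Qed.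

Let sum_bracket_var a : a \in S ->
  \sum_(k < size (dp a)) brL (h j) (dp a)`_k * t ^+ k
    = (apoly a).[t] * h j + (dp a)^`().[t].
Proof.
move=> aS.
have -> : \sum_(k < size (dp a)) brL (h j) (dp a)`_k * t ^+ k
    = \sum_(k < nilpotency_bound D a) brL (h j) (dp a)`_k * t ^+ k.
  rewrite (big_ord_widen _ (fun k => brL (h j) (dp a)`_k * t ^+ k) (size_dpoly a)).
  rewrite big_mkcond; apply: eq_bigr => k _; case: ltnP => // sk.
  by rewrite nth_default // (pbr_skew brP) (pbr0 brP) oppr0 mul0r.
rewrite (horner_coef_wide (p := (dp a)^`()) t (n := nilpotency_bound D a)); last first.
  by apply: leq_trans (size_dpoly a); apply/leq_trans/leq_pred; exact: size_poly.
rewrite horner_poly mulr_suml -big_split /=.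
apply: eq_bigr => k _; rewrite (coef_dpoly D_nilp) // coef_deriv_dpoly //.
by rewrite bracket_var_mmap ?(higher_stable D_higher) //; ring.
Qed.

(** The bracket with h_j yields an extra term (dp a)'(t). Since eta t h_j = 1, it equals eta t (dp
    a)'(t) h_j, the part of [dp (alpha a)] that comes from the commutation of [alpha] with D_i. *)
Lemma bracket_var_shift : {in S, forall a,
  brL (h j) (mmap iL h' a) = mmap iL h' (alpha a) * h j}.
Proof.
move=> a aS; rewrite !(mmap_shift D_higher D_nilp) ?alpha_stable //.
have dpa : dp (alpha a) = apoly a + (iL eta)%:P * 'X * (dp a)^`().
  apply/polyP => k; rewrite coefD -mulrA coefCM coefXM coef_apoly //.
  rewrite (coef_dpoly D_nilp) ?alpha_stable //; case: D_skew => _ _ -> //.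
  rewrite mmapD mmapZ; congr (_ + _); case: k => [|k] /=.
    by rewrite mul0r rmorph0 mul0r mulr0.
  by rewrite coef_deriv (coef_dpoly D_nilp) // rmorphM rmorph_nat -mulr_natl; ring.
have brt : brL t (h j) = 0.
  apply: (mulIf hj); apply: (addrI (t * brL (h j) (h j))).
  rewrite -(pbr_leibniz brP) divfK // (pbr_scalar brP) (pbr_alternating brP).
  by rewrite mulr0 mul0r addr0.
rewrite (pbr_skew brP) (bracket_hornerl brP) brt mulr0 addr0 -sumrN.
under eq_bigr do rewrite -mulNr -(pbr_skew brP).
rewrite sum_bracket_var // dpa !(hornerD, hornerM, hornerX, hornerC).
transitivity ((apoly a).[t] * h j + iL eta * t * h j * (dp a)^`().[t]); last by ring.
by rewrite eta_t mul1r.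
Qed.

End ShiftBracket.

(** * Poisson isomorphisms from fraction fields *)

Lemma poisson_isomorphic_sym (K : fieldType) (R S : comNzRingType)
    (iR : K -> R) brR (iS : K -> S) brS :
  poisson_isomorphic iR brR iS brS -> poisson_isomorphic iS brS iR brR.
Proof.
move=> [f [fB [f1 fM] fi fbr [g fK gK]]]; have finj := can_inj fK.
exists g; split.
- by move=> x y; apply: finj; rewrite fB !gK.
- by split=> [|x y]; apply: finj; rewrite ?fM !gK.
- by move=> c; apply: finj; rewrite fi gK.
- by move=> x y; apply: finj; rewrite fbr !gK.
- by exists f.
Qed.

Section FractionIsomorphism.

Variables (K : fieldType) (R : idomainType) (iR : {rmorphism K -> R}).
Variables (br : R -> R -> R) (L : fieldType) (iL : {rmorphism K -> L}).
Variables (brL : L -> L -> L) (phi : {rmorphism R -> L}).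
Hypothesis brP : poisson_bracket iR br.
Hypothesis brLP : poisson_bracket iL brL.
Hypothesis phi_scalar : forall c, phi (iR c) = iL c.
Hypothesis phi_bracket : {morph phi : a b / br a b >-> brL a b}.
Hypothesis phi_inj : injective phi.
Hypothesis phi_gen : forall x, exists a b, phi b != 0 /\ x = phi a / phi b.

Let phi_neq0 a : (phi a != 0) = (a != 0).
Proof. by rewrite -(rmorph0 phi) (inj_eq phi_inj). Qed.

Let bracket_divl x y z : y != 0 ->
  brL (x / y) z = (y * brL x z - x * brL y z) / y ^+ 2.
Proof.
move=> y0; have := pbr_leibniz brLP (x / y) y z; rewrite divfK // => ->.
by field.
Qed.

Let bracket_div x y z w : y != 0 -> w != 0 ->
  brL (x / y) (z / w) =
    (y * w * brL x z - x * w * brL y z - y * z * brL x w + x * z * brL y w)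
      / (y * w) ^+ 2.
Proof.
move=> y0 w0; rewrite bracket_divl // !(pbr_skew brLP _ (z / w)) !bracket_divl //.
rewrite !(pbr_skew brLP z) !(pbr_skew brLP w); field.
by rewrite y0 w0.
Qed.

Definition frac_map (x : {fraction R}) : L :=
  phi (\n_(repr x))%qT / phi (\d_(repr x))%qT.

Let frac_mapE a b : b != 0 -> frac_map (a%:F / b%:F) = phi a / phi b.
Proof.
move=> b0; rewrite /frac_map; set x := a%:F / b%:F.
have d0 : \d_(repr x) != 0 by exact: denom_ratioP.
apply/eqP; rewrite eqr_div ?phi_neq0 // -!rmorphM (inj_eq phi_inj) -tofrac_eq.
by rewrite !tofracM -eqr_div ?tofrac_eq0 // -fraction_repr.
Qed.

(** The quotient rule holds in any Poisson field, so the extension of [phi] to fractions respects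
    brackets; surjectivity is [phi_gen]. *)
Lemma fraction_isomorphic :
  poisson_isomorphic (@tofrac R \o iR) (frac_bracket br) iL brL.
Proof.
have F0 b : b != 0 -> b%:F != 0 :> {fraction R} by rewrite tofrac_eq0.
have mapF a : frac_map a%:F = phi a.
  by rewrite -[a%:F]divr1 -tofrac1 frac_mapE ?oner_neq0 // rmorph1 divr1.
have mapB : zmod_morphism frac_map.
  elim/fraction_ind=> a b b0; elim/fraction_ind=> c d d0.
  rewrite -mulNr addf_div ?F0 // -tofracN -!tofracM -tofracD.
  rewrite !frac_mapE ?mulf_neq0 // -mulNr addf_div ?phi_neq0 //.
  by rewrite rmorphD !rmorphM rmorphN.
have mapM : {morph frac_map : x y / x * y}.
  elim/fraction_ind=> a b b0; elim/fraction_ind=> c d d0.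
  rewrite mulf_div -!tofracM !frac_mapE ?mulf_neq0 //.
  by rewrite !rmorphM mulf_div.
have map_inj : injective frac_map.
  elim/fraction_ind=> a b b0; elim/fraction_ind=> c d d0.
  rewrite !frac_mapE // => /eqP; rewrite eqr_div ?phi_neq0 // -!rmorphM.
  rewrite (inj_eq phi_inj) => /eqP e; apply/eqP.
  by rewrite eqr_div ?F0 // -!tofracM e.
exists frac_map; split=> //.
- by split=> //; rewrite -tofrac1 mapF rmorph1.
- by move=> c; rewrite /= mapF.
- elim/fraction_ind=> a b b0; elim/fraction_ind=> c d d0.
  rewrite (frac_bracketE brP) // /ratio_bracket frac_mapE; last first.
    by rewrite expf_neq0 // mulf_neq0.
  rewrite !frac_mapE // bracket_div ?phi_neq0 // -!phi_bracket.
  by rewrite !(rmorphB, rmorphD, rmorphM, rmorphXn).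
- have pre x : exists y, frac_map y = x.
    have [a [b [b0 ->]]] := phi_gen x; exists (a%:F / b%:F).
    by rewrite frac_mapE // -phi_neq0.
  exists (fun x => projT1 (cid (pre x))) => [y|x].
    by apply: map_inj; case: cid.
  by case: cid.
Qed.

End FractionIsomorphism.

(** * Kernels of maps to a field as Poisson prime ideals *)

Section Kernel.

Variables (R : comNzRingType) (L : fieldType) (phi : {rmorphism R -> L}).

Definition kernel : {pred R} := fun x => phi x == 0.

Lemma kernelE x : (x \in kernel) = (phi x == 0). Proof. by []. Qed.

Fact kernel_zmod : zmod_closed kernel.
Proof.
split=> [|x y]; rewrite !kernelE ?rmorph0 // => /eqP x0 /eqP y0.
by rewrite rmorphB x0 y0 subrr.
Qed.

Fact kernel_proper :
  1 \notin kernel /\ forall a, {in kernel, forall u, a * u \in kernel}.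
Proof.
split=> [|a u]; rewrite !kernelE ?rmorph1 ?oner_neq0 // => /eqP u0.
by rewrite rmorphM u0 mulr0.
Qed.

Fact kernel_prime : prime_idealr_closed kernel.
Proof. by move=> u v; rewrite !kernelE rmorphM mulf_eq0. Qed.

HB.instance Definition _ := GRing.isZmodClosed.Build R kernel kernel_zmod.
HB.instance Definition _ := isProperIdeal.Build R kernel kernel_proper.
HB.instance Definition _ := isPrimeIdealrClosed.Build R kernel kernel_prime.

Definition quot_map (x : {ideal_quot kernel}) : L := phi (repr x).

Lemma quot_mapE x : quot_map (\pi_{ideal_quot kernel} x)%qT = phi x.
Proof.
apply/eqP; rewrite /quot_map -subr_eq0 -rmorphB -kernelE.
by rewrite Quotient.idealrBE reprK.
Qed.

Fact quot_map_zmod : zmod_morphism quot_map.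
Proof.
by elim/quotW=> x; elim/quotW=> y; rewrite -rmorphB !quot_mapE rmorphB.
Qed.

Fact quot_map_monoid : monoid_morphism quot_map.
Proof.
split=> [|]; first by rewrite -(rmorph1 \pi_{ideal_quot kernel}%qT) quot_mapE rmorph1.
by elim/quotW=> x; elim/quotW=> y; rewrite -rmorphM !quot_mapE rmorphM.
Qed.

HB.instance Definition _ := GRing.isZmodMorphism.Build _ _ quot_map quot_map_zmod.
HB.instance Definition _ := GRing.isMonoidMorphism.Build _ _ quot_map quot_map_monoid.

Lemma quot_map_inj : injective quot_map.
Proof.
elim/quotW=> x; elim/quotW=> y; rewrite !quot_mapE => e; apply/eqP.
by rewrite -Quotient.idealrBE kernelE rmorphB e subrr.
Qed.

Variables (K : fieldType) (iR : {rmorphism K -> R}) (br : R -> R -> R).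
Variables (iL : {rmorphism K -> L}) (brL : L -> L -> L).
Hypothesis brP : poisson_bracket iR br.
Hypothesis brLP : poisson_bracket iL brL.
Hypothesis phi_scalar : forall c, phi (iR c) = iL c.
Hypothesis phi_bracket : {morph phi : a b / br a b >-> brL a b}.
Hypothesis phi_gen : forall x, exists a b, phi b != 0 /\ x = phi a / phi b.

Lemma kernel_poisson : poisson_ideal br kernel.
Proof.
move=> a u; rewrite !kernelE phi_bracket => /eqP ->.
by rewrite (pbr_skew brLP) (pbr0 brLP) oppr0.
Qed.

(** The induced map on the quotient is injective with the same image, so [fraction_isomorphic]
    applies to it. *)
Lemma kernel_quotient_isomorphic :
  poisson_isomorphic
    (@tofrac {ideal_quot kernel} \o \pi_{ideal_quot kernel}%qT \o iR)
    (frac_bracket (@quot_bracket _ br kernel)) iL brL.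
Proof.
apply: (@fraction_isomorphic K {ideal_quot kernel}
  (\pi_{ideal_quot kernel}%qT \o iR) _ L iL brL quot_map).
- exact: quot_bracket_poisson brP kernel_poisson.
- exact: brLP.
- by move=> c; rewrite -phi_scalar; exact: quot_mapE.
- elim/quotW=> x; elim/quotW=> y.
  rewrite (quot_bracketE brP kernel_poisson).
  by rewrite /= !quot_mapE phi_bracket.
- exact: quot_map_inj.
- move=> x; have [a [b [b0 ->]]] := phi_gen x.
  exists (\pi_{ideal_quot kernel} a)%qT, (\pi_{ideal_quot kernel} b)%qT.
  by rewrite /= !quot_mapE.
Qed.

End Kernel.

(** * Successive deletion of the derivations *)

Section DerivationDeletion.

Variables (K : fieldType) (n : nat).
Local Notation A := {mpoly K[n]}.
Variables (br : A -> A -> A) (alpha delta : 'I_n -> A -> A).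
Variables (D : 'I_n -> nat -> A -> A) (eta : 'I_n -> K) (lambda : 'M[K]_n).
Hypothesis A_ore : iterated_poisson_ore br alpha delta.
Hypothesis eta_neq0 : forall i : 'I_n, (0 < i)%N -> eta i != 0.
Hypothesis D_extends : forall i : 'I_n, (0 < i)%N ->
  {in vars_below i, forall a, D i 1%N a = delta i a}.
Hypothesis D_skew : forall i : 'I_n, (0 < i)%N ->
  higher_skew_poisson_on br (vars_below i) (eta i) (alpha i) (D i).
Hypothesis D_iterative : forall i : 'I_n, (0 < i)%N ->
  iterative_on (vars_below i) (D i).
Hypothesis D_nilpotent : forall i : 'I_n, (0 < i)%N ->
  locally_nilpotent_on (vars_below i) (D i).
Hypothesis lambda_skew : skew_symmetric_mx lambda.
Hypothesis alphaX : forall i j : 'I_n, (j < i)%N ->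
  alpha i 'X_j = lambda i j *: 'X_j.
Hypothesis alphaD : forall i j : 'I_n, (0 < j)%N -> (j < i)%N -> forall k : nat,
  {in vars_below j, forall a,
    alpha i (D j k a) = D j k (alpha i a) + (k%:R * lambda i j) *: D j k a}.

Lemma D_higher (i : 'I_n) : (0 < i)%N -> higher_derivation_on (vars_below i) (D i).
Proof. by move=> i0; case: (D_skew i0). Qed.

Lemma alpha_derivation (i : 'I_n) : (0 < i)%N -> derivation_on (vars_below i) (alpha i).
Proof. by move=> i0; case: (ipo_alpha A_ore i0). Qed.

Section PoissonField.

Variables (L : fieldType) (iL : {rmorphism K -> L}) (brL : L -> L -> L).
Hypothesis brLP : poisson_bracket iL brL.
Implicit Type h : 'I_n -> L.

(* h realises in L the algebra obtained from A after deleting the derivations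
   delta_i with i >= m. *)
Definition partially_deleted (m : nat) h : Prop :=
  {in vars_below m &, forall a b,
     mmap iL h (br a b) = brL (mmap iL h a) (mmap iL h b)} /\
  forall i k : 'I_n, (m <= i)%N -> (k < i)%N ->
    brL (h i) (h k) = iL (lambda i k) * (h i * h k).

(** Both sides are derivations along evaluation at [h], so agreement on the variables suffices. *)
Lemma bracket_deleted_var (l : 'I_n) h : (0 < l)%N ->
  (forall k : 'I_n, (k < l)%N -> brL (h l) (h k) = iL (lambda l k) * (h l * h k)) ->
  {in vars_below l, forall a,
     brL (h l) (mmap iL h a) = mmap iL h (alpha l a) * h l}.
Proof.
move=> l0 hl; have [[_ lin] leib] := alpha_derivation l0.
apply: vars_below_ind => [a b aS bS ea eb|a b aS bS ea eb|c|k kl].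
- have := lin 1 a b aS bS; rewrite !scale1r => ->.
  by rewrite !mmapD (pbrDr brLP) ea eb mulrDl.
- by rewrite leib // mmapD !mmapM (pbrMr brLP) ea eb; ring.
- rewrite (derivation_on_scalar (alpha_derivation l0)) mmapA mmap0 mul0r (pbr_skew brLP) (pbr_scalar brLP).
  by rewrite oppr0.
- by rewrite mmap_var hl // alphaX // mmapZ mmap_var; ring.
Qed.

(** The compatibility of a torus element with the D_i, expressed through its weights alone. *)
Definition compatible_weights (mu : 'I_n -> K) : Prop :=
  (forall i, mu i != 0) /\
  forall (i k : 'I_n) e, (0 < i)%N -> (k < i)%N ->
    diagonal_map mu (D i e 'X_k) = (mu i ^+ e * mu k) *: D i e 'X_k.

Definition scale (mu : 'I_n -> K) h : 'I_n -> L := fun i => iL (mu i) * h i.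

(** With [g = scale mu h] this says that the kernel at [h] is stable in both directions under
    [diagonal_map mu]. *)
Definition same_kernel h g : Prop :=
  forall p, mmap iL h p = 0 <-> mmap iL g p = 0.

(** What a deletion must transmit: generation for the field isomorphisms, injectivity for Frac A,
    and stability of the kernel for torus invariance. *)
Definition refines h h' : Prop :=
  [/\ generates iL h -> generates iL h',
      (forall p, mmap iL h p = 0 -> p = 0) ->
        forall p, mmap iL h' p = 0 -> p = 0 &
      forall mu, compatible_weights mu ->
        same_kernel h (scale mu h) -> same_kernel h' (scale mu h')].

(** On D_{i,e}(X_k) the derivation alpha_l acts by lambda_lk + e lambda_li, and {h_l, t^e} = - e
    lambda_li h_l t^e. Hence every term of the shifted value has the same coefficient lambda_lk. *)
Lemma bracket_deleted_shift (i l k : 'I_n) h (c := (eta i)^-1)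
    (h' := shift i (D i) iL c h) :
  (0 < i)%N -> (i < l)%N -> (k < i)%N -> h i != 0 ->
  partially_deleted i.+1 h ->
  brL (h l) (h' k) = iL (lambda l k) * (h l * h' k).
Proof.
move=> i0 il ki hi [_ hdel].
have l0 : (0 < l)%N by apply: leq_trans il.
have XS := vars_belowX K ki.
rewrite /h' !shift_lt //; set t := iL c / h i; set p := dpoly _ _ _ _.
have brt : brL t (h l) = iL (lambda l i) * t * h l.
  apply: (mulIf hi); apply: (addrI (t * brL (h i) (h l))).
  rewrite -(pbr_leibniz brLP) divfK // (pbr_scalar brLP).
  by rewrite (pbr_skew brLP) hdel //; ring.
rewrite (pbr_skew brLP) (bracket_hornerl brLP) brt opprD -sumrN.
under eq_bigr do rewrite -mulNr -(pbr_skew brLP).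
rewrite horner_deriv_sum -mulNr -!sumrN !mulr_suml -big_split /=.
rewrite horner_coef !mulr_sumr; apply: eq_bigr => e _.
rewrite (coef_dpoly (D_nilpotent i0)) //.
rewrite bracket_deleted_var // => [|k' k'l|]; first last.
- by apply: (vars_below_le (ltnW il)); apply: (higher_stable (D_higher i0)).
- by apply: hdel.
rewrite alphaD // alphaX ?(ltn_trans ki) // (higherZ (D_higher i0)) // mmapD !mmapZ.
rewrite rmorphM rmorph_nat; case: (nat_of_ord e) => [|e'] /=.
  by rewrite !mulr0n; ring.
by rewrite -mulr_natl exprS; ring.
Qed.

Lemma deletion_step (i : 'I_n) h : (0 < i)%N -> partially_deleted i.+1 h ->
  exists2 h', partially_deleted i h' & refines h h'.
Proof.
move=> i0 hpd; have [hbr hdel] := hpd.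
(* If h_i = 0, the relations required of h_i read 0 = 0 and the point is kept. *)
have [hi|hi] := eqVneq (h i) 0.
  exists h; last by split.
  split=> [a b aS bS|l k].
    by apply: hbr; apply: vars_below_le (leqnSn i) _ _.
  rewrite leq_eqVlt => /orP[/eqP/val_inj <- ki|]; last exact: hdel.
  by rewrite hi (pbr0 brLP) mul0r mulr0.
(* This choice of [c] gives t = 1 / (eta_i h_i). *)
pose c := (eta i)^-1; exists (shift i (D i) iL c h).
  split.
    apply: (mmap_shift_bracket (alpha := alpha i) (delta := delta i)) => //.
    - exact: (ipo_closed A_ore).
    - exact: alpha_derivation.
    - exact: (ipo_bracket A_ore i0).
    - exact: D_extends.
    - exact: D_skew.
    - exact: D_nilpotent.
    - exact: D_iterative.
    - exact: eta_neq0.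
  move=> l k; rewrite leq_eqVlt => /orP[/eqP/val_inj <- ki|il kl].
    rewrite (shift_ge _ _ _ _ (leqnn i)).
    have := bracket_var_shift (alpha_derivation i0) (ipo_bracket A_ore i0)
      (D_extends i0) (D_skew i0) (D_nilpotent i0) (D_iterative i0)
      (eta_neq0 i0) brLP hi hbr (vars_belowX K ki).
    by rewrite alphaX // mmapZ !mmap_var => ->; ring.
  rewrite (shift_ge _ _ _ _ (ltnW il)); have [ki|ik] := ltnP k i.
    exact: bracket_deleted_shift.
  by rewrite shift_ge // hdel.
split.
- exact: shift_generates (D_higher i0) (D_nilpotent i0) _ _ _ _ (D_iterative i0) hi.
- exact: shift_injective (D_higher i0) (D_nilpotent i0) _ _ _ _ (D_iterative i0) hi.
move=> mu [mu0 eigen] ker.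
(* Scaling commutes with the shift, and both [h] and the scaled point are nonzero at [i], so the two
   kernel inclusions pass to the shifted points. *)
have smi : scale mu h i != 0 by rewrite mulf_neq0 ?fmorph_eq0.
have e : shift i (D i) iL c (scale mu h) =1 scale mu (shift i (D i) iL c h).
  by apply: shift_scale => // k m ki; apply: eigen.
move=> p; rewrite -(mmap_eq iL e).
by split; apply: shift_kernel => // q /ker.
Qed.

Lemma affine_fraction_isomorphic h :
  {morph mmap iL h : p q / affine_bracket lambda p q >-> brL p q} ->
  generates iL h -> (forall p, mmap iL h p = 0 -> p = 0) ->
  poisson_isomorphic iL brL
    (@tofrac A \o in_alg A) (frac_bracket (affine_bracket lambda)).
Proof.
move=> hbr gen inj; apply: poisson_isomorphic_sym.
apply: (fraction_isomorphic (phi := mmap iL h) (affine_bracket_poisson lambda_skew)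
  brLP) => //.
- by move=> c; exact: mmapA.
- exact: raddf_inj inj.
Qed.

Lemma affine_kernel_isomorphic h (Q := kernel (mmap iL h)) :
  {morph mmap iL h : p q / affine_bracket lambda p q >-> brL p q} ->
  generates iL h ->
  poisson_ideal (affine_bracket lambda) Q /\
  poisson_isomorphic iL brL
    (@tofrac {ideal_quot Q} \o \pi_{ideal_quot Q}%qT \o in_alg A)
    (frac_bracket (@quot_bracket _ (affine_bracket lambda) Q)).
Proof.
move=> hbr gen; have afP := affine_bracket_poisson lambda_skew.
split; first exact: (kernel_poisson brLP hbr).
apply: poisson_isomorphic_sym.
by apply: (kernel_quotient_isomorphic afP brLP) => // c; exact: mmapA.
Qed.

Lemma deletion h : (0 < n)%N -> partially_deleted n h ->
  exists2 h', {morph mmap iL h' : p q / affine_bracket lambda p q >-> brL p q}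
    & refines h h'.
Proof.
move=> n_gt0 hn.
have [h' [h'br h'del] hh'] : exists2 h', partially_deleted 1 h' & refines h h'.
  suff H k : (k < n)%N ->
      exists2 h', partially_deleted (n - k) h' & refines h h'.
    have e : (n - n.-1 = 1)%N by rewrite -{1}(prednK n_gt0) subSnn.
    by have := H n.-1; rewrite e ltn_predL; apply.
  elim: k => [|k IH] kn; first by exists h; rewrite ?subn0.
  have [h1 h1p [r1 r2 r3]] := IH (ltnW kn).
  (* The next index is n - k - 1; it is positive because k + 1 < n, and its successor is the stage n
     - k already reached. *)
  have ik : (n - k.+1 < n)%N by rewrite ltn_subrL.
  have i0 : (0 < Ordinal ik)%N by rewrite subn_gt0.
  have := @deletion_step (Ordinal ik) h1 i0; rewrite /= (subnSK (ltnW kn)) => /(_ h1p).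
  case=> h2 h2p [s1 s2 s3]; exists h2 => //; split.
  - by move=> /r1/s1.
  - by move=> /r2/s2.
  - by move=> mu mu_ok /r3 => /(_ mu_ok)/s3; apply.
exists h' => //; have [lamC lam0] := lambda_skew.
(* Stage 1 provides the relations for k < i; skew-symmetry and alternation give the others. *)
have brX (i k : 'I_n) : brL (h' i) (h' k) = iL (lambda i k) * (h' i * h' k).
  have lt (a b : 'I_n) : (b < a)%N ->
      brL (h' a) (h' b) = iL (lambda a b) * (h' a * h' b).
    by move=> ba; apply: h'del => //; apply: leq_ltn_trans ba.
  have [ik|ki|/val_inj ->] := ltngtP i k.
  - by rewrite (pbr_skew brLP) lt // [lambda i k]lamC rmorphN; ring.
  - exact: lt.
  - by rewrite (pbr_alternating brLP) lam0 rmorph0 mul0r.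
have afP := affine_bracket_poisson lambda_skew.
(* Both brackets are biderivations along evaluation at [h'], so only pairs of variables need
   checking. *)
move=> p q; elim/mpoly_gen_ind: p => [p1 p2 e1 e2|p1 p2 e1 e2|c|i].
- by rewrite (pbrD afP) !mmapD (pbrD brLP) e1 e2.
- by rewrite (pbr_leibniz afP) mmapD !mmapM (pbr_leibniz brLP) e1 e2.
- by rewrite mmapA (pbr_scalar brLP) (pbr_scalar afP) mmap0.
elim/mpoly_gen_ind: q => [p1 p2 e1 e2|p1 p2 e1 e2|c|k].
- by rewrite (pbrDr afP) !mmapD (pbrDr brLP) e1 e2.
- by rewrite (pbrMr afP) mmapD !mmapM (pbrMr brLP) e1 e2.
- rewrite mmapA (pbr_skew brLP) (pbr_skew afP) (pbr_scalar brLP).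
  by rewrite (pbr_scalar afP) !oppr0 mmap0.
- by rewrite affine_bracketX mmapZ mmapM !mmap_var brX.
Qed.

End PoissonField.

Hypothesis n_gt0 : (0 < n)%N.

(** * Deletion starting from a domain onto which A maps, such as A or A / P *)

Section Domain.

Variables (R : idomainType) (brR : R -> R -> R) (iR : {rmorphism K -> R}).
Variable phi : {rmorphism A -> R}.
Hypothesis brRP : poisson_bracket iR brR.
Hypothesis phi_scalar : forall c, phi c%:A = iR c.
Hypothesis phi_bracket : {morph phi : a b / br a b >-> brR a b}.
Hypothesis phi_surj : forall x, exists a, phi a = x.

Let iF : {rmorphism K -> {fraction R}} := @tofrac R \o iR.
Let h (i : 'I_n) : {fraction R} := (phi 'X_i)%:F.
Let brFP : poisson_bracket iF (frac_bracket brR) := frac_bracket_poisson brRP.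

Let hE p : mmap iF h p = (phi p)%:F.
Proof.
by apply: (mmap_rmorph (phi := @tofrac R \o phi)) => c; rewrite /= phi_scalar.
Qed.

Let deletion_domain : exists h' : 'I_n -> {fraction R},
  [/\ {morph mmap iF h' : p q / affine_bracket lambda p q >-> frac_bracket brR p q},
      generates iF h' & refines iF h h'].
Proof.
(* At stage n nothing is deleted: the first condition says that [phi] is a Poisson map, and the
   second is vacuous. *)
have pd : partially_deleted iF (frac_bracket brR) n h.
  split=> [a b _ _|i k]; last by rewrite leqNgt ltn_ord.
  by rewrite !hE (frac_bracket_tofrac brRP) phi_bracket.
have [h' h'br hh'] := deletion brFP n_gt0 pd; exists h'; split=> //.
have [gen _ _] := hh'; apply: gen; elim/fraction_ind=> x y y0.
have [[a ax] [b bY]] := (phi_surj x, phi_surj y).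
by exists a, b; rewrite !hE ax bY tofrac_eq0.
Qed.

Lemma deletion_injective : injective phi ->
  poisson_isomorphic (@tofrac R \o iR) (frac_bracket brR)
    (@tofrac A \o in_alg A) (frac_bracket (affine_bracket lambda)).
Proof.
move=> inj; have [h' [h'br gen [_ inj' _]]] := deletion_domain.
apply: (affine_fraction_isomorphic brFP h'br gen); apply: inj' => p.
rewrite hE => /eqP; rewrite tofrac_eq0 => /eqP p0.
by apply: inj; rewrite p0 rmorph0.
Qed.

Lemma deletion_prime : exists Q : prime_idealr A,
  [/\ poisson_ideal (affine_bracket lambda) Q,
      poisson_isomorphic (@tofrac R \o iR) (frac_bracket brR)
        (@tofrac {ideal_quot Q} \o \pi_{ideal_quot Q}%qT \o in_alg A)
        (frac_bracket (@quot_bracket _ (affine_bracket lambda) Q)) &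
      forall mu, compatible_weights mu ->
        (forall p, phi p = 0 <-> phi (diagonal_map mu p) = 0) ->
        forall p, p \in Q <-> diagonal_map mu p \in Q].
Proof.
have [h' [h'br gen [_ _ ker']]] := deletion_domain.
have [Qpoisson Qiso] := affine_kernel_isomorphic brFP h'br gen.
exists (kernel (mmap iF h')); split; [exact: Qpoisson|exact: Qiso|].
move=> mu mu_ok Pmu p; rewrite !kernelE /= mmap_diagonal.
(* Evaluation at the scaled point is evaluation of the diagonal image, so stability of the kernel of
   [phi] is the hypothesis transported by [refines]. *)
have ker : same_kernel iF h (scale iF mu h).
  move=> q; rewrite /scale -mmap_diagonal !hE.
  have [Pq Pq'] := Pmu q.
  by split=> /eqP; rewrite tofrac_eq0 => /eqP; [move/Pq|move/Pq'] => ->; rewrite tofrac0.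
by split=> /eqP/(ker' mu mu_ok ker)/eqP.
Qed.

End Domain.

End DerivationDeletion.

(** * Application to A, to A / P and to torus-invariant P *)

Theorem theorem3p3 (K : fieldType) (n : nat) (n_gt0 : (0 < n)%N)
    (br : {mpoly K[n]} -> {mpoly K[n]} -> {mpoly K[n]})
    (alpha delta : 'I_n -> {mpoly K[n]} -> {mpoly K[n]})
    (D : 'I_n -> nat -> {mpoly K[n]} -> {mpoly K[n]})
    (eta : 'I_n -> K) (lambda : 'M[K]_n)
    (A_ore : iterated_poisson_ore br alpha delta)
    (eta_neq0 : forall i : 'I_n, (0 < i)%N -> eta i != 0)
    (D_extends : forall i : 'I_n, (0 < i)%N ->
       {in vars_below i, forall a, D i 1%N a = delta i a})
    (D_skew : forall i : 'I_n, (0 < i)%N ->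
       higher_skew_poisson_on br (vars_below i) (eta i) (alpha i) (D i))
    (D_iterative : forall i : 'I_n, (0 < i)%N ->
       iterative_on (vars_below i) (D i))
    (D_nilpotent : forall i : 'I_n, (0 < i)%N ->
       locally_nilpotent_on (vars_below i) (D i))
    (lambda_skew : skew_symmetric_mx lambda)
    (alphaX : forall i j : 'I_n, (j < i)%N ->
       alpha i 'X_j = lambda i j *: 'X_j)
    (alphaD : forall i j : 'I_n, (0 < j)%N -> (j < i)%N -> forall k : nat,
       {in vars_below j, forall a,
         alpha i (D j k a) = D j k (alpha i a)
                             + (k%:R * lambda i j) *: D j k a}) :
  [/\ frac_isomorphic br (affine_bracket lambda),
      forall P : prime_idealr {mpoly K[n]}, poisson_ideal br P ->
        exists2 Q : prime_idealr {mpoly K[n]},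
          poisson_ideal (affine_bracket lambda) Q &
          frac_quot_isomorphic br P (affine_bracket lambda) Q
    & forall (r : nat) (act : 'rV[K]_r -> {mpoly K[n]} -> {mpoly K[n]})
        (mu : 'rV[K]_r -> 'I_n -> K),
        rational_poisson_action act br ->
        {in torus K r, forall h i,
          mu h i != 0 /\ act h 'X_i = mu h i *: 'X_i} ->
        {in torus K r, forall h (i j : 'I_n) (k : nat), (j < i)%N ->
          act h (D i k 'X_j) = mu h i ^+ k *: D i k (act h 'X_j)} ->
        forall P : prime_idealr {mpoly K[n]},
          poisson_ideal br P -> torus_invariant act P ->
          exists Q : prime_idealr {mpoly K[n]},
            [/\ poisson_ideal (affine_bracket lambda) Q,
                torus_invariant (fun h => diagonal_map (mu h)) Q &
                frac_quot_isomorphic br P (affine_bracket lambda) Q]].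
Proof.
(* One ideal [Q] serves the last two assertions; the third clause carries diagonal stability from
   [P] to [Q]. *)
have quotients (P : prime_idealr {mpoly K[n]}) : poisson_ideal br P ->
    exists Q : prime_idealr {mpoly K[n]},
      [/\ poisson_ideal (affine_bracket lambda) Q,
          frac_quot_isomorphic br P (affine_bracket lambda) Q &
          forall nu, compatible_weights D nu ->
            (forall p, p \in P <-> diagonal_map nu p \in P) ->
            forall p, p \in Q <-> diagonal_map nu p \in Q].
  move=> PP; pose pi : {rmorphism {mpoly K[n]} -> {ideal_quot P}} :=
    \pi_{ideal_quot P}%qT.
  have pi0 p : pi p = 0 <-> p \in P.
    rewrite -[X in X \in P]subr0 Quotient.idealrBE -(rmorph0 pi).
    by split=> /eqP.
  have [|||Q [QP iso Qmu]] := deletion_prime A_ore eta_neq0 D_extends D_skew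
    D_iterative D_nilpotent lambda_skew alphaX alphaD n_gt0 (phi := pi)
    (quot_bracket_poisson (ipo_poisson A_ore) PP).
  - by [].
  - by move=> a b; rewrite (quot_bracketE (ipo_poisson A_ore) PP).
  - by elim/quotW=> x; exists x.
  exists Q; split; [exact: QP|exact: iso|move=> nu nu_ok Pnu]; apply: Qmu nu_ok _ => p.
  exact: iff_trans (pi0 p) (iff_trans (Pnu p) (iff_sym (pi0 _))).
split.
- pose idA : {rmorphism {mpoly K[n]} -> {mpoly K[n]}} := idfun.
  have idA_surj x : exists a, idA a = x by exists x.
  have idA_scalar c : idA c%:A = in_alg _ c by [].
  have idA_bracket : {morph idA : a b / br a b} by [].
  have idA_inj : injective idA by [].
  exact: (deletion_injective A_ore eta_neq0 D_extends D_skew D_iterative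
    D_nilpotent lambda_skew alphaX alphaD n_gt0
    (ipo_poisson A_ore) idA_scalar idA_bracket idA_surj idA_inj).
- move=> P PP; have [Q [QP iso _]] := quotients P PP.
  by exists Q.
move=> r act mu act_rat act_X act_D P PP Pact.
have [Q [QP iso Qmu]] := quotients P PP.
exists Q; split=> // g gT.
have [actB [act1 actM] actA _ act_bij] := rpa_auto act_rat gT.
have mu0 i : mu g i != 0 by case: (act_X g gT i).
(* Both are algebra maps with the same values on the variables. *)
have actE : act g =1 diagonal_map (mu g).
  have actD p q : act g (p + q) = act g p + act g q.
    have act0 : act g 0 = 0 by rewrite -[X in act g X](subrr 0) actB subrr.
    have actN x : act g (- x) = - act g x by rewrite -sub0r actB act0 sub0r.
    by rewrite -[q in LHS]opprK actB actN opprK.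
  elim/mpoly_gen_ind=> [p q ep eq|p q ep eq|c|i].
  - by rewrite actD ep eq diagonal_mapD.
  - by rewrite actM ep eq diagonal_mapM.
  - by rewrite [LHS]actA diagonal_mapA.
  - by have [_ ->] := act_X g gT i; rewrite diagonal_mapX.
have mu_ok : compatible_weights D (mu g).
  split=> // i k e i0 ki.
  rewrite -actE act_D //; have [_ ->] := act_X g gT k.
  by rewrite (higherZ (D_higher D_skew i0)) ?vars_belowX // scalerA.
have Pg p : p \in P <-> diagonal_map (mu g) p \in P.
  (* Invariance is stated through preimages; injectivity of [act g] identifies the preimage of
     [act g p] with [p]. *)
  have Pa := Pact g gT (act g p); rewrite -actE.
  split=> [pP|/Pa[b bP /(bij_inj act_bij) <- //]].
  by apply/Pa; exists p.
(* The inverse weights supply the preimage in [Q] that invariance demands. *)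
pose nu i := (mu g i)^-1.
have diagK : cancel (diagonal_map nu) (diagonal_map (mu g)).
  by apply: diagonal_mapK => i; rewrite mulfV.
move=> a; split=> [aQ|[b bQ <-]]; last exact: (proj1 (Qmu _ mu_ok Pg b)).
exists (diagonal_map nu a); last exact: diagK.
by apply: (proj2 (Qmu _ mu_ok Pg _)); rewrite diagK.
Qed.
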